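(* Let $N\ge 1$, $p>2$, let $u_0$ satisfy $u_0\in W^{1,\infty}(\mathbb{R}^N)$, $u_0\ge 0$, $u_0\not\equiv 0$ and $\mathrm{supp}(u_0)\subset B(0,R_0)$ for some $R_0>0$, and let $u$ be the solution of the Cauchy problem $$\partial_t u-\Delta_p u+|\nabla u|^{p-1}=0 \ \text{ in } (0,\infty)\times\mathbb{R}^N,\qquad u(0,\cdot)=u_0 \ \text{ in } \mathbb{R}^N .$$ Then, as $t\to\infty$, $u$ decays in time like $\|u(t)\|_{L^\infty(\mathbb{R}^N)}=O\big(t^{-1/(p-2)}(\log t)^{(p-1)/(p-2)}\big)$ and its support spreads in space like $O(\log t)$ (that is, $\sup\{|x| : u(t,x)>0\}=O(\log t)$). More precisely, $$\lim_{t\to\infty}\ \sup_{x\in\mathbb{R}^N}\left|\frac{c_p\,t^{1/(p-2)}}{(\log t)^{(p-1)/(p-2)}}\,u(t,x)-\left(1-\frac{(p-2)|x|}{\log t}\right)_+^{(p-1)/(p-2)}\right|=0,$$ where $c_p=(p-2)^{1/(p-2)}(p-1)^{(p-1)/(p-2)}$.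
   Context: $\Delta_p u:=\mathrm{div}(|\nabla u|^{p-2}\nabla u)$ is the $p$-Laplacian, $r_+=\max\{r,0\}$, and $B(0,R)$ is the ball of radius $R$ centred at $0$ in $\mathbb{R}^N$. By the solution of the Cauchy problem is meant its unique non-negative viscosity solution $u\in\mathcal{BC}([0,\infty)\times\mathbb{R}^N)\cap L^\infty(0,\infty;W^{1,\infty}(\mathbb{R}^N))$, where $\mathcal{BC}$ denotes bounded continuous functions (existence and uniqueness are known). *)

(* Defs.v *)
From HB Require Import structures.
From mathcomp Require Import all_boot all_order all_algebra.
From mathcomp Require Import all_classical all_reals all_analysis.

Set Implicit Arguments.
Unset Strict Implicit.
Unset Printing Implicit Defensive.

Import Order.TTheory GRing.Theory Num.Theory.
Import numFieldNormedType.Exports.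

Local Open Scope classical_set_scope.
Local Open Scope ring_scope.

Section lebesgue_cons.
Context {R : realType} {n : nat}.
Local Open Scope ereal_scope.
Notation RT := (measurableTypeR R).
Variable m : {measure set (n.-tuple RT) -> \bar R}.

Definition tuple_cons (z : n.-tuple RT * RT) : n.+1.-tuple RT :=
  [the n.+1.-tuple RT of z.2 :: z.1].

Lemma measurable_tuple_cons : measurable_fun [set: _] tuple_cons.
Proof. exact: measurable_cons. Qed.

Definition lebesgue_cons : set (n.+1.-tuple RT) -> \bar R :=
  pushforward (m \x (@lebesgue_measure R)) tuple_cons.

Let lebesgue_cons0 : lebesgue_cons set0 = 0.
Proof. by rewrite /lebesgue_cons measure0 //; exact: measurable_tuple_cons. Qed.

Let lebesgue_cons_ge0 A : 0 <= lebesgue_cons A.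
Proof. exact: integral_ge0. Qed.

Let lebesgue_cons_sigma_additive : semi_sigma_additive lebesgue_cons.
Proof.
apply: measure_semi_sigma_additive; exact: measurable_tuple_cons.
Qed.

HB.instance Definition _ := isMeasure.Build _ _ _ lebesgue_cons
  lebesgue_cons0 lebesgue_cons_ge0 lebesgue_cons_sigma_additive.

End lebesgue_cons.

(* The measure lives on tuples, whose sigma-algebra is the product one; a
   function on R^n = 'rV[R]_n is integrated through [rv_of_tuple]. *)
Fixpoint lebesgueN (R : realType) (n : nat) :
    {measure set (n.-tuple (measurableTypeR R)) -> \bar R} :=
  match n with
  | 0 => \d_ [tuple]
  | n'.+1 => lebesgue_cons (lebesgueN R n')
  end.

Lemma lebesgueN_box (R : realType) (n : nat)
    (A : 'I_n -> set (measurableTypeR R)) : (forall i, measurable (A i)) ->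
  (lebesgueN R n [set t | forall i, A i (tnth t i)] =
   \prod_(i < n) lebesgue_measure (A i))%E.
Proof.
elim: n A => [|n IH] A mA.
  rewrite big_ord0 /= diracE mem_set//= => -[]; by [].
rewrite big_ord_recl /= /lebesgue_cons /pushforward.
have -> : tuple_cons @^-1` [set t | forall i, A i (tnth t i)] =
  [set t : n.-tuple _ | forall i, A (lift ord0 i) (tnth t i)] `*` A ord0.
  apply/seteqP; split=> [[t x] /= H|[t x] /= [H1 H2] i].
    split=> [i|]; last by have := H ord0; rewrite tnth0.
    by have := H (lift ord0 i); rewrite tnthS.
  by case: (unliftP ord0 i) => [j ->|->]; rewrite ?tnthS ?tnth0.
have mB : measurable [set t : n.-tuple (measurableTypeR R) |
    forall i, A (lift ord0 i) (tnth t i)].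
  have -> : [set t : n.-tuple (measurableTypeR R) |
        forall i, A (lift ord0 i) (tnth t i)] =
      \bigcap_(i in [set: 'I_n]) ((@tnth n _ ^~ i) @^-1` A (lift ord0 i)).
    by apply/seteqP; split=> t /= H i => [_|]; apply: H.
  apply: fin_bigcap_measurable => // i _.
  by rewrite -[X in measurable X]setTI; apply: measurable_tnth.
rewrite product_measure1E//.
by rewrite muleC; congr (_ * _)%E;
  exact: (IH (fun i => A (lift ord0 i)) (fun i => mA _)).
Qed.

Definition rv_of_tuple (R : realType) (n : nat)
    (t : n.-tuple (measurableTypeR R)) : 'rV[R]_n := \row_i tnth t i.

(* The norm [`|x|] of the library on 'rV[R]_n is the sup norm. *)
Definition enorm (R : realType) (n : nat) (x : 'rV[R]_n) : R :=
  Num.sqrt (\sum_(i < n) x 0 i ^+ 2).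

Definition partial (R : realType) (n : nat) (i : 'I_n)
    (f : 'rV[R]_n -> R) (x : 'rV[R]_n) : R :=
  'D_(delta_mx 0 i) f x.

Definition grad (R : realType) (n : nat) (f : 'rV[R]_n -> R)
    (x : 'rV[R]_n) : 'rV[R]_n :=
  \row_i partial i f x.

Definition divergence (R : realType) (n : nat) (F : 'rV[R]_n -> 'rV[R]_n)
    (x : 'rV[R]_n) : R :=
  \sum_(i < n) partial i (fun y => F y 0 i) x.

(* For p > 2 and f of class C^2 the vector field below is of class C^1, also at
   the critical points of f. *)
Definition p_laplacian (R : realType) (n : nat) (p : R) (f : 'rV[R]_n -> R) :
    'rV[R]_n -> R :=
  divergence (fun y => enorm (grad f y) `^ (p - 2) *: grad f y).

Definition smooth (R : realType) (n : nat) (f : 'rV[R]_n -> R) : Prop :=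
  forall s : seq 'I_n, let g := foldr (@partial R n) f s in
    continuous g /\ forall i x, derivable g x (delta_mx 0 i).

Definition test_function (R : realType) (n : nat) (f : 'rV[R]_n -> R) : Prop :=
  smooth f /\ compact (closure [set x | f x != 0]).

Definition Linfty_le (R : realType) (n : nat) (f : 'rV[R]_n -> R) (M : R) :
    Prop :=
  measurable_fun [set: n.-tuple (measurableTypeR R)] (f \o @rv_of_tuple R n) /\
  ('N[lebesgueN R n]_+oo[EFin \o f \o @rv_of_tuple R n] <= M%:E)%E.

Definition weak_partial (R : realType) (n : nat) (i : 'I_n)
    (f g : 'rV[R]_n -> R) : Prop :=
  forall h : 'rV[R]_n -> R, test_function h ->
    \int[lebesgueN R n]_t (f (rv_of_tuple t) * partial i h (rv_of_tuple t)) =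
    - \int[lebesgueN R n]_t (g (rv_of_tuple t) * h (rv_of_tuple t)).

(* f lies in W^{1,oo} and its norm, the largest of the L^oo norms of f and of
   its first order weak derivatives, is at most M. *)
Definition W1oo_le (R : realType) (n : nat) (f : 'rV[R]_n -> R) (M : R) :
    Prop :=
  Linfty_le f M /\
  forall i : 'I_n, exists2 g, weak_partial i f g & Linfty_le g M.

Definition W1oo (R : realType) (n : nat) (f : 'rV[R]_n -> R) : Prop :=
  exists M : R, W1oo_le f M.

Definition partial_t (R : realType) (n : nat) (f : R -> 'rV[R]_n -> R)
    (t : R) (x : 'rV[R]_n) : R :=
  derive1 (f ^~ x) t.

Definition continuous_pos (R : realType) (n : nat) (f : R -> 'rV[R]_n -> R) :
    Prop :=
  forall (t : R) (x : 'rV[R]_n), 0 < t ->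
    {for (t, x), continuous (fun z : R * 'rV[R]_n => f z.1 z.2)}.

(* Class C^{1,2} on (0, oo) x R^n: once in time, twice in space; the values for
   t <= 0 are irrelevant. *)
Record C12_pos (R : realType) (n : nat) (f : R -> 'rV[R]_n -> R) : Prop := {
  C12_cont : continuous_pos f;
  C12_derivable_t : forall t x, 0 < t -> derivable (f ^~ x) t 1;
  C12_cont_t : continuous_pos (partial_t f);
  C12_derivable_x : forall i t x, 0 < t ->
    derivable (f t) x (delta_mx 0 i);
  C12_cont_x : forall i, continuous_pos (fun t => partial i (f t));
  C12_derivable_xx : forall i j t x, 0 < t ->
    derivable (partial i (f t)) x (delta_mx 0 j);
  C12_cont_xx : forall i j,
    continuous_pos (fun t => partial j (partial i (f t)))
}.

Definition pde_lhs (R : realType) (n : nat) (p : R) (f : R -> 'rV[R]_n -> R)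
    (t : R) (x : 'rV[R]_n) : R :=
  partial_t f t x - p_laplacian p (f t) x + enorm (grad (f t) x) `^ (p - 1).

(* Semicontinuity is not required here: both notions are only applied to
   continuous functions. *)
Definition viscosity_subsolution (R : realType) (n : nat) (p : R)
    (u : R -> 'rV[R]_n -> R) : Prop :=
  forall (f : R -> 'rV[R]_n -> R) (t : R) (x : 'rV[R]_n),
    C12_pos f -> 0 < t ->
    (\forall z \near (t, x), u z.1 z.2 - f z.1 z.2 <= u t x - f t x) ->
    pde_lhs p f t x <= 0.

Definition viscosity_supersolution (R : realType) (n : nat) (p : R)
    (u : R -> 'rV[R]_n -> R) : Prop :=
  forall (f : R -> 'rV[R]_n -> R) (t : R) (x : 'rV[R]_n),
    C12_pos f -> 0 < t ->
    (\forall z \near (t, x), u t x - f t x <= u z.1 z.2 - f z.1 z.2) ->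
    0 <= pde_lhs p f t x.

Record cauchy_solution (R : realType) (n : nat) (p : R) (u0 : 'rV[R]_n -> R)
    (u : R -> 'rV[R]_n -> R) : Prop := {
  sol_continuous : {within [set z : R * 'rV[R]_n | 0 <= z.1],
    continuous (fun z => u z.1 z.2)};
  sol_bounded : exists M : R, forall t x, 0 <= t -> `|u t x| <= M;
  sol_ge0 : forall t x, 0 <= t -> 0 <= u t x;
  (* u in L^oo(0, oo; W^{1,oo}), in the usual weak sense: W^{1,oo} is not
     separable and strong measurability in t is not meant. *)
  sol_W1oo : exists M : R,
    \forall t \ae (@lebesgue_measure R), 0 < t -> W1oo_le (u t) M;
  sol_sub : viscosity_subsolution p u;
  sol_super : viscosity_supersolution p u;
  sol_init : forall x, u 0 x = u0 x
}.

(* Main.v *)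
Require Import Defs.
From mathcomp Require Import all_boot all_order all_algebra.
From mathcomp Require Import all_classical all_reals all_analysis.
From mathcomp Require Import ess_sup_inf ring lra.

Set Implicit Arguments.
Unset Strict Implicit.
Unset Printing Implicit Defensive.

Import Order.TTheory GRing.Theory Num.Theory.
Import numFieldNormedType.Exports.

Local Open Scope classical_set_scope.
Local Open Scope ring_scope.

(** The planar functions
      v(t, s) = C t^(-1/(p-2)) (log t / (p-2) + A - s)_+^((p-1)/(p-2)),
      C = (p-2) (p-1)^(-(p-1)/(p-2)),
    are exact solutions of the equation in one space variable: diffusion pushes
    the front s = log t / (p-2) + A, absorption makes the amplitude decay.  With
    s = |x| they are, up to the shift A, the profile of the theorem, and the
    theorem follows by squeezing u between radial perturbations of them.

    Comparison is elementary.  If f is of class C^{1,2}, a negative minimum of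
    u - f over a compact slab that is attained inside it makes f a test function
    for u; so u >= f as soon as f is a strict subsolution wherever f > u, and f
    is below u on the boundary of the slab ([comparison_below]; the upper
    version is [comparison_above]).  All barriers therefore have the globally
    smooth form f(t,x) = b(t) G(a(t) - phi(x)) + k(t), where
    phi(x) = sqrt(K^2 + |x - y|^2) smooths the distance to a centre y.  The
    positive part is smoothed to L(z) = (z + sqrt(z^2 + eta^2)) / 2 and G is
    L^((p-1)/(p-2)).  The term k(t) = d exp(lam (t - T)) is at most d up to time
    T, exceeds any prescribed bound at time 2T, which settles the final time of
    the slab, and its derivative provides strictness.  The left-hand side of the
    equation is computed exactly in [pde_lhs_power_barrier].

    Upper bound ([upper_bound]).  First, u is small at infinity on every bounded
    time interval: compare it with shallow cones ([decay_at_infinity]).  Then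
    let the centre y run away from the origin along the half-line opposite to
    x, so that phi becomes planar.  The regularization errors vanish as eta goes
    to 0 and |y| to infinity, and
      u(t, x) <= C (t+1)^(-1/(p-2)) (A + log(t+1)/(p-2) - |x|)_+^((p-1)/(p-2)).

    Lower bound ([subsolution_bound]).  In dimension N the curvature of the
    level sets adds to the absorption a term of size at most (N+p-2)/K, and near
    the centre, where |grad phi| < 1, diffusion no longer pushes the front.  Both
    defects are paid for by a slightly faster decay of the amplitude (a factor
    Lam > 1) and a slightly slower front (a factor th < 1), provided that the
    initial support reaches far enough from the centre.  With K = 1 and a tiny
    th any initial support is large enough, and the support of u is seen to
    spread over the whole space ([positivity_spreads]).  With K of order 1/eps
    and Lam, th within 2 eps of 1 the bound is sharp to leading order, and at a
    late time u dominates such a barrier because the amplitude of the barrier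
    may be taken small ([lower_bound]).

    Finally, [front_asymptotics] says that the fronts of both bounds are
    equivalent to (th/Lam) log t / (p-2), whatever the shifts in time and space,
    and uniform continuity of powers converts the two bounds into the limit. *)

(** * Real powers and directional derivatives *)

Lemma powR_pred {R : realType} (x r : R) : 0 < x -> x `^ (r - 1) = x `^ r / x.
Proof. by move=> x0; rewrite powRB ?powRr1 ?(ltW x0)// (gt_eqF x0) implybT. Qed.

Lemma powR_succ {R : realType} (x r : R) : 0 < x -> x `^ (r + 1) = x `^ r * x.
Proof. by move=> x0; rewrite powRD ?powRr1 ?(ltW x0)// (gt_eqF x0) implybT. Qed.

Lemma powRVN {R : realType} (x r : R) : 0 <= x -> x^-1 `^ r = x `^ (- r).
Proof. by move=> x0; rewrite -powR_inv1// -powRrM mulN1r. Qed.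

Lemma powR_homo {R : realType} (r x y : R) : 0 <= r -> 0 <= x -> x <= y ->
  x `^ r <= y `^ r.
Proof.
by move=> r0 x0 xy; apply: (ge0_ler_powR r0); rewrite // nnegrE (le_trans x0).
Qed.

Lemma powR_le1 {R : realType} (x r : R) : 0 <= x -> x <= 1 -> 0 <= r ->
  x `^ r <= 1.
Proof.
move=> x0 x1 r0; have := @ge0_ler_powR R r r0 x 1; rewrite powR1.
by apply; rewrite ?nnegrE.
Qed.

Section directional_calculus.
Context {R : realType} {V : normedModType R}.
Implicit Types (f g : V -> R) (x v : V).

(** Directional derivatives only see the restriction to a line; this reduces the
    chain rule for them to one variable. *)
Lemma is_derive_line f x v df :
  is_derive x v f df <-> is_derive (0 : R) 1 (fun h : R => f (h *: v + x)) df.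
Proof.
have E : 'D_v f x = 'D_1 (fun h : R => f (h *: v + x)) 0.
  rewrite /derive; set g1 := fun h => h^-1 *: _; set g2 := fun h => h^-1 *: _.
  suff -> : g1 = g2 by [].
  by apply/funext => h; rewrite /g1 /g2 /= addr0 scale0r add0r [_%:A]mulr1.
split=> -[d <-]; (split; last by rewrite E).
  exact: (derivable1P f x v).1 d.
exact: (derivable1P f x v).2 d.
Qed.

Lemma is_derive_comp1 (F : R -> R) g x v dF dg :
  is_derive (g x) 1 F dF -> is_derive x v g dg ->
  is_derive x v (fun y => F (g y)) (dF * dg).
Proof.
move=> HF /is_derive_line Hg; apply/is_derive_line.
apply: (@is_derive1_comp _ F (fun h : R => g (h *: v + x))) => //.
by rewrite scale0r add0r.
Qed.

Lemma is_derive_add f g x v df dg :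
  is_derive x v f df -> is_derive x v g dg ->
  is_derive x v (fun y => f y + g y) (df + dg).
Proof. exact: is_deriveD. Qed.

Lemma is_derive_sub f g x v df dg :
  is_derive x v f df -> is_derive x v g dg ->
  is_derive x v (fun y => f y - g y) (df - dg).
Proof. exact: is_deriveB. Qed.

Lemma is_derive_mul f g x v df dg :
  is_derive x v f df -> is_derive x v g dg ->
  is_derive x v (fun y => f y * g y) (f x * dg + g x * df).
Proof. exact: is_deriveM. Qed.

Lemma is_derive_const (c : R) x v : is_derive x v (fun=> c) 0.
Proof. exact: is_derive_cst. Qed.

Lemma is_derive_scale (c : R) f x v df :
  is_derive x v f df -> is_derive x v (fun y => c * f y) (c * df).
Proof. exact: is_deriveZ. Qed.

Lemma is_derive_powR f (r : R) x v df : 0 < f x ->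
  is_derive x v f df ->
  is_derive x v (fun y => f y `^ r) (r * f x `^ (r - 1) * df).
Proof.
by move=> f0 ?; apply: (@is_derive_comp1 (@powR R ^~ r)); first exact: is_derive1_powR.
Qed.

Lemma is_derive_sqrt f x v df : 0 < f x ->
  is_derive x v f df ->
  is_derive x v (fun y => Num.sqrt (f y)) (df / (2 * Num.sqrt (f x))).
Proof.
by move=> f0 ?; rewrite mulrC; apply: (@is_derive_comp1 Num.sqrt);
  first exact: is_derive1_sqrt.
Qed.

Lemma is_derive_div f g x v df dg : g x != 0 ->
  is_derive x v f df -> is_derive x v g dg ->
  is_derive x v (fun y => f y / g y) ((df * g x - f x * dg) / g x ^+ 2).
Proof.
move=> g0 Hf Hg; have Hi := is_derive_comp1
  (@is_deriveV R id (g x) 1 1 g0 (is_derive_id _ _)) Hg.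
apply: (is_derive_eq (is_derive_mul Hf Hi)).
by rewrite /GRing.scale/=; field.
Qed.

End directional_calculus.

(** * The Euclidean norm and the smoothed distance to a point *)

Section smooth_distance.
Context {R : realType} {N : nat}.
Implicit Types (x y : 'rV[R]_N) (K : R).

Definition sqnorm x : R := \sum_(i < N) x 0 i ^+ 2.

Lemma sqnorm_ge0 x : 0 <= sqnorm x.
Proof. by apply: sumr_ge0 => i _; exact: sqr_ge0. Qed.

Lemma enormE x : enorm x = Num.sqrt (sqnorm x). Proof. by []. Qed.

Lemma enorm_ge0 x : 0 <= enorm x. Proof. exact: sqrtr_ge0. Qed.

Lemma enorm_sqr x : enorm x ^+ 2 = sqnorm x.
Proof. by rewrite sqr_sqrtr// sqnorm_ge0. Qed.

Lemma enormZ (c : R) x : enorm (c *: x) = `|c| * enorm x.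
Proof.
rewrite /enorm -sqrtr_sqr -sqrtrM ?sqr_ge0//; congr Num.sqrt.
by rewrite mulr_sumr; apply: eq_bigr => i _; rewrite mxE exprMn.
Qed.

Lemma enorm_eq0 x : enorm x = 0 -> x = 0.
Proof.
move=> H; have /eqP := enorm_sqr x; rewrite H expr0n/= eq_sym.
rewrite [_ == _]psumr_eq0 => [/allP E|i _]; last exact: sqr_ge0.
apply/rowP => i; rewrite mxE; apply/eqP; rewrite -sqrf_eq0.
by have := E i (mem_index_enum i).
Qed.

Lemma coord_le_enorm x i : `|x 0 i| <= enorm x.
Proof.
rewrite -sqrtr_sqr ler_sqrt ?sqnorm_ge0// (bigD1 i)//= lerDl.
by apply: sumr_ge0 => j _; exact: sqr_ge0.
Qed.

Lemma norm_le_enorm x : `|x| <= enorm x.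
Proof.
rewrite [leLHS]/Num.norm /= mx_normrE; apply: bigmax_le; first exact: enorm_ge0.
by move=> [i j] _ /=; rewrite ord1; exact: coord_le_enorm.
Qed.

(** Weighted form of (a + b)^2 <= (1 + s) a^2 + (1 + 1/s) b^2, coordinate by
    coordinate, with the optimal s = |y| / |x|. *)
Lemma enormD x y : enorm (x + y) <= enorm x + enorm y.
Proof.
have [/enorm_eq0 ->|x0] := eqVneq (enorm x) 0; first by rewrite add0r lerDr enorm_ge0.
have [/enorm_eq0 ->|y0] := eqVneq (enorm y) 0; first by rewrite addr0 lerDl enorm_ge0.
set A := enorm x in x0 *; set B := enorm y in y0 *.
have {}x0 : 0 < A by rewrite lt_def x0 enorm_ge0.
have {}y0 : 0 < B by rewrite lt_def y0 enorm_ge0.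
have AB : 0 <= A + B by rewrite addr_ge0 ?enorm_ge0.
rewrite -(@ler_sqr _ (enorm (x + y))) ?nnegrE ?enorm_ge0// enorm_sqr.
apply: (@le_trans _ _ (\sum_(i < N) ((1 + B / A) * x 0 i ^+ 2
     + (1 + A / B) * y 0 i ^+ 2))).
  apply: ler_sum => i _; rewrite mxE -subr_ge0.
  have -> : (1 + B / A) * x 0 i ^+ 2 + (1 + A / B) * y 0 i ^+ 2
     - (x 0 i + y 0 i) ^+ 2 = (B * x 0 i - A * y 0 i) ^+ 2 / (A * B).
    by field; rewrite !gt_eqF.
  by rewrite divr_ge0 ?sqr_ge0// mulr_ge0 ?ltW.
rewrite big_split/= -!mulr_sumr -!/(sqnorm _) -!enorm_sqr -/A -/B.
rewrite le_eqVlt; apply/orP; left; apply/eqP.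
by field; rewrite !gt_eqF.
Qed.

Lemma is_derive_coord x i j :
  is_derive x (delta_mx 0 j) (fun z : 'rV[R]_N => z 0 i) (i == j)%:R.
Proof.
apply/is_derive_line.
have -> : (fun h : R => (h *: delta_mx 0 j + x : 'rV[R]_N) 0 i) =
          (fun h => (i == j)%:R * h + x 0 i).
  by apply/funext => h; rewrite !mxE eqxx/= mulrC.
apply: (is_derive_eq (is_derive_add (is_derive_scale _ (is_derive_id _ _))
  (is_derive_const _ _ _))).
by rewrite mulr1 addr0.
Qed.

Lemma is_derive_sqnorm y x j :
  is_derive x (delta_mx 0 j) (fun z => sqnorm (z - y)) (2 * (x - y) 0 j).
Proof.
have -> : (fun z : 'rV[R]_N => sqnorm (z - y)) =
  \sum_(i < N) (fun z : 'rV[R]_N => (z 0 i - y 0 i) * (z 0 i - y 0 i)).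
  apply/funext => z; rewrite fct_sumE; apply: eq_bigr => i _.
  by rewrite !mxE expr2.
apply: (is_derive_eq (is_derive_sum (fun i => is_derive_mul
  (is_derive_sub (is_derive_coord x i j) (is_derive_const _ _ _))
  (is_derive_sub (is_derive_coord x i j) (is_derive_const _ _ _))))).
rewrite (bigD1 j)//= big1 ?eqxx => [|i ij]; first by rewrite !mxE/= ?(mulr1n,subr0); ring.
by rewrite (negbTE ij) subr0 !mulr0 addr0.
Qed.

Definition sdist K y x : R := Num.sqrt (K ^+ 2 + sqnorm (x - y)).

Section sdist.
Variables (K : R) (y : 'rV[R]_N).
Hypothesis K0 : 0 < K.
Local Notation phi := (sdist K y).
Local Notation w x := ((x - y) 0).

Lemma sdist_sqr x : phi x ^+ 2 = K ^+ 2 + enorm (x - y) ^+ 2.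
Proof. by rewrite enorm_sqr sqr_sqrtr// addr_ge0 ?sqr_ge0 ?sqnorm_ge0. Qed.

Lemma sdist_gt0 x : 0 < phi x.
Proof. by rewrite sqrtr_gt0 ltr_pwDl ?exprn_gt0 ?sqnorm_ge0. Qed.

Lemma sdist_neq0 x : phi x != 0. Proof. by rewrite gt_eqF// sdist_gt0. Qed.

Lemma sdist_geK x : K <= phi x.
Proof.
rewrite -ler_sqr ?nnegrE ?(ltW K0) ?(ltW (sdist_gt0 _))//.
by rewrite sdist_sqr lerDl sqr_ge0.
Qed.

Lemma sdist_ge_enorm x : enorm (x - y) <= phi x.
Proof.
rewrite -ler_sqr ?nnegrE ?enorm_ge0 ?(ltW (sdist_gt0 _))//.
by rewrite sdist_sqr lerDr sqr_ge0.
Qed.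

Lemma sdist_le x : phi x <= K + enorm (x - y).
Proof.
have w0 := enorm_ge0 (x - y).
rewrite -ler_sqr ?nnegrE ?addr_ge0 ?(ltW K0) ?(ltW (sdist_gt0 _))// sdist_sqr.
by rewrite sqrrD lerD2r lerDl mulrn_wge0// mulr_ge0// ltW.
Qed.

Lemma is_derive_sdist x j :
  is_derive x (delta_mx 0 j) phi (w x j / phi x).
Proof.
have p0 : 0 < K ^+ 2 + sqnorm (x - y).
  by rewrite ltr_pwDl ?exprn_gt0 ?sqnorm_ge0.
apply: (is_derive_eq (is_derive_sqrt (f := fun z => K ^+ 2 + sqnorm (z - y))
  p0 (is_derive_add (is_derive_const _ _ _) (is_derive_sqnorm y x j)))).
by rewrite -/(phi x) add0r; field; rewrite sdist_neq0.
Qed.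

Lemma is_derive_sub_coord x i j :
  is_derive x (delta_mx 0 j) (fun z : 'rV[R]_N => w z i) (i == j)%:R.
Proof.
have -> : (fun z : 'rV[R]_N => w z i) = (fun z => z 0 i - y 0 i).
  by apply/funext => z; rewrite !mxE.
apply: (is_derive_eq (is_derive_sub (is_derive_coord _ _ _)
  (is_derive_const _ _ _))).
by rewrite subr0.
Qed.

Lemma is_derive_grad_sdist x i j :
  is_derive x (delta_mx 0 j) (fun z => w z i / phi z)
    (((i == j)%:R - w x i * w x j / phi x ^+ 2) / phi x).
Proof.
apply: (is_derive_eq (is_derive_div (g := phi) (sdist_neq0 x)
  (is_derive_sub_coord x i j) (is_derive_sdist x j))).
by field; exact: sdist_neq0.
Qed.

Lemma continuous_sub_coord i : continuous (fun z : 'rV[R]_N => w z i).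
Proof.
have -> : (fun z : 'rV[R]_N => w z i) = (fun z => z 0 i - y 0 i).
  by apply/funext => z; rewrite !mxE.
by move=> x; apply: continuousB; [exact: coord_continuous|exact: cst_continuous].
Qed.

Lemma continuous_sqnorm_sub : continuous (fun z : 'rV[R]_N => sqnorm (z - y)).
Proof.
move=> x.
have -> : (fun z : 'rV[R]_N => sqnorm (z - y)) =
  \sum_(i < N) (fun z : 'rV[R]_N => w z i * w z i).
  apply/funext => z; rewrite fct_sumE.
  by apply: eq_bigr => i _; rewrite expr2.
apply: (big_ind (fun f : 'rV[R]_N -> R => {for x, continuous f})).
- exact: cst_continuous.
- by move=> f g; exact: continuousD.
- by move=> i _; apply: continuousM; exact: continuous_sub_coord.
Qed.

Lemma continuous_sdist : continuous phi.
Proof.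
move=> x; apply: continuous_comp; last exact: sqrt_continuous.
by apply: continuousD; [exact: cst_continuous|exact: continuous_sqnorm_sub].
Qed.

(** The field |w|^m w is C^1 even at the zero of w because m > 0: there its
    difference quotients are |h|^m.  The formula covers that point too, since
    0 `^ m = 0. *)
Lemma is_derive_powR_enorm_coord (m : R) x i : 0 < m ->
  is_derive x (delta_mx 0 i) (fun z => enorm (z - y) `^ m * w z i)
    (enorm (x - y) `^ m * (1 + m * (w x i / enorm (x - y)) ^+ 2)).
Proof.
move=> m0; have [w0|w0] := eqVneq (enorm (x - y)) 0.
  have E := enorm_eq0 w0.
  rewrite w0 powR0 ?gt_eqF// mul0r; apply/is_derive_line.
  have -> : (fun h : R => enorm (h *: delta_mx 0 i + x - y) `^ m
      * w (h *: delta_mx 0 i + x) i) = (fun h : R => `|h| `^ m * h).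
    apply/funext => h; rewrite -addrA E addr0 enormZ !mxE !eqxx/= mulr1.
    suff -> : enorm (delta_mx 0 i : 'rV[R]_N) = 1 by rewrite mulr1.
    rewrite /enorm (bigD1 i)//= big1 => [|j ij]; rewrite !mxE ?eqxx/=.
      by rewrite addr0 expr1n sqrtr1.
    by rewrite (negbTE ij) expr0n.
  have L : (fun h : R => h^-1 *: ((((fun h : R => `|h| `^ m * h) \o shift 0) (h *: 1))
         - (`|0 : R| `^ m * 0))) @ 0^' --> (0 : R).
    have C : (fun h : R => `|h| `^ m) @ 0^' --> (0 : R).
      apply/cvgrPdist_lt => e e0; rewrite near_withinE.
      near=> h => hn0; rewrite sub0r normrN ger0_norm ?powR_ge0//.
      rewrite -[ltRHS](@powRr1 _ e) ?ltW// -(@mulVf _ m) ?gt_eqF// powRrM.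
      rewrite gt0_ltr_powR ?nnegrE ?powR_ge0//.
      near: h; exists (e `^ m^-1); rewrite /= ?powR_gt0//.
      by move=> z /=; rewrite sub0r normrN.
    refine (cvg_trans _ C); apply: near_eq_cvg; rewrite near_withinE.
    near=> h => hn0 /=.
    by rewrite mulr0 subr0 addr0 [h *: 1]mulr1 /GRing.scale/=; field.
  split; first by apply/cvg_ex; exists 0; exact: L.
  by apply/cvg_lim; [exact: Rhausdorff|exact: L].
have {}w0 : 0 < enorm (x - y) by rewrite lt_def w0 enorm_ge0.
have s0 : 0 < sqnorm (x - y) by rewrite -sqrtr_gt0.
apply: (is_derive_eq (is_derive_mul (is_derive_powR (f := fun z => enorm (z - y)) m w0 (is_derive_sqrt (f := fun z => sqnorm (z - y)) s0
  (is_derive_sqnorm y x i))) (is_derive_sub_coord x i i))).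
have -> : enorm (x - y) `^ (m - 1) = enorm (x - y) `^ m / enorm (x - y).
  exact: powR_pred.
rewrite eqxx -!/(sqnorm _) -!enormE.
by rewrite [true%:R]/= mulr1n; field; rewrite gt_eqF.
Unshelve. all: by end_near. Qed.

End sdist.
End smooth_distance.

(** * Barriers b(t) G(a(t) - phi(x)) + k(t) *)

Section barrier.
Context {R : realType} {N : nat}.
Implicit Types (t : R) (x : 'rV[R]_N).

Record C1_nneg (f f' : R -> R) : Prop := {
  C1_nneg_derive : forall t : R, 0 <= t -> is_derive t 1 f (f' t);
  C1_nneg_cont : forall t : R, 0 <= t -> {for t, continuous f'} }.

(** [H1] is the derivative of the one-dimensional flux |G'|^m G', the only second
    order quantity that the p-Laplacian of a barrier sees along the gradient. *)
Record C2_profile (m : R) (G G1 G2 H1 : R -> R) : Prop := {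
  C2_profile_D1 : forall z : R, is_derive z 1 G (G1 z);
  C2_profile_D2 : forall z : R, is_derive z 1 G1 (G2 z);
  C2_profile_cont : continuous G2;
  C2_profile_flux : forall z : R,
    is_derive z 1 (fun z => `|G1 z| `^ m * G1 z) (H1 z) }.

Lemma is_derive_continuous (f : R -> R) (t df : R) :
  is_derive t 1 f df -> {for t, continuous f}.
Proof.
by move=> [d _]; apply/differentiable_continuous/derivable1_diffP.
Qed.

Variables (p : R) (b b' a a' k k' G G1 G2 H1 : R -> R) (K : R) (y : 'rV[R]_N).
Hypotheses (p2 : 2 < p) (K0 : 0 < K).
Hypotheses (Cb : C1_nneg b b') (Ca : C1_nneg a a') (Ck : C1_nneg k k').
Hypothesis CG : C2_profile (p - 2) G G1 G2 H1.
Hypothesis b_gt0 : forall t : R, 0 <= t -> 0 < b t.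
Local Notation phi := (sdist K y).
Local Notation w x := ((x - y) 0).

Definition barrier (t : R) (x : 'rV[R]_N) : R := b t * G (a t - phi x) + k t.

Local Notation zeta t x := (a t - phi x).

Lemma is_derive_comp_zeta (F F1 : R -> R) t x j :
  (forall z : R, is_derive z 1 F (F1 z)) ->
  is_derive x (delta_mx 0 j) (fun x => F (zeta t x))
    (F1 (zeta t x) * - (w x j / phi x)).
Proof.
move=> HF; apply: (@is_derive_comp1 _ _ F (fun x => zeta t x)) => //.
rewrite -sub0r.
exact: (is_derive_sub (is_derive_const _ _ _) (is_derive_sdist y K0 x j)).
Qed.

Lemma is_derive_barrier_x t x j :
  is_derive x (delta_mx 0 j) (barrier t)
    (- (b t * G1 (zeta t x)) * (w x j / phi x)).
Proof.
apply: (is_derive_eq (is_derive_add (is_derive_scale (b t)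
  (is_derive_comp_zeta t x j (C2_profile_D1 CG))) (is_derive_const (k t) _ _))).
by rewrite addr0; ring.
Qed.

Lemma partial_barrier t j : partial j (barrier t) =
  (fun x => - (b t * G1 (zeta t x)) * (w x j / phi x)).
Proof.
by apply/funext => x; rewrite /partial; have [_ ->] := is_derive_barrier_x t x j.
Qed.

Lemma is_derive_barrier_xx t x i j :
  is_derive x (delta_mx 0 j) (partial i (barrier t))
    (b t * G2 (zeta t x) * (w x i / phi x) * (w x j / phi x)
     - b t * G1 (zeta t x) *
       (((i == j)%:R - w x i * w x j / phi x ^+ 2) / phi x)).
Proof.
have -> : partial i (barrier t) =
    (fun x => - b t * (G1 (zeta t x) * (w x i / phi x))).
  by rewrite partial_barrier; apply/funext => z; ring.
apply: (is_derive_eq (is_derive_scale (- b t) (is_derive_mul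
  (is_derive_comp_zeta t x j (C2_profile_D2 CG))
  (is_derive_grad_sdist y K0 x i j)))).
by field; exact: sdist_neq0.
Qed.

Lemma is_derive_barrier_t (t : R) x : 0 <= t ->
  is_derive t 1 (barrier ^~ x)
    (b' t * G (zeta t x) + b t * (G1 (zeta t x) * a' t) + k' t).
Proof.
move=> t0.
have D := is_derive_add (is_derive_mul (C1_nneg_derive Cb t0)
  (is_derive_comp1 (g := fun t => zeta t x) (C2_profile_D1 CG _)
    (is_derive_sub (C1_nneg_derive Ca t0) (is_derive_const (phi x) _ _))))
  (C1_nneg_derive Ck t0).
by apply: (is_derive_eq D); ring.
Qed.

Let cont_t (c : R -> R) (t : R) (x : 'rV[R]_N) : {for t, continuous c} ->
  {for (t, x), continuous (fun z : R * 'rV[R]_N => c z.1)}.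
Proof. by move=> cc; apply: (@continuous_comp _ _ _ (@fst R 'rV[R]_N) c); [exact: cvg_fst|exact: cc]. Qed.

Let cont_x (c : 'rV[R]_N -> R) (t : R) (x : 'rV[R]_N) : {for x, continuous c} ->
  {for (t, x), continuous (fun z : R * 'rV[R]_N => c z.2)}.
Proof. by move=> cc; apply: (@continuous_comp _ _ _ (@snd R 'rV[R]_N) c); [exact: cvg_snd|exact: cc]. Qed.

Let cont_zeta (F : R -> R) (t : R) x : 0 <= t -> continuous F ->
  {for (t, x), continuous (fun z : R * 'rV[R]_N => F (zeta z.1 z.2))}.
Proof.
move=> t0 cF.
have C : {for (t, x), continuous (fun z : R * 'rV[R]_N => zeta z.1 z.2)}.
  apply: continuousB; last exact: (@cont_x phi t x (@continuous_sdist _ _ K y x)).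
  exact: (@cont_t a t x (is_derive_continuous (C1_nneg_derive Ca t0))).
exact: (continuous_comp C (cF _)).
Qed.

Let cG : continuous G.
Proof. by move=> z; apply: is_derive_continuous (C2_profile_D1 CG z). Qed.
Let cG1 : continuous G1.
Proof. by move=> z; apply: is_derive_continuous (C2_profile_D2 CG z). Qed.
Let cb (t : R) : 0 <= t -> {for t, continuous b}.
Proof. by move=> t0; apply: is_derive_continuous (C1_nneg_derive Cb t0). Qed.

Lemma continuous_barrier (t : R) x : 0 <= t ->
  {for (t, x), continuous (fun z : R * 'rV[R]_N => barrier z.1 z.2)}.
Proof.
move=> t0; apply: continuousD.
  by apply: continuousM; [exact: (@cont_t b t x (cb t0))|exact: cont_zeta].
exact: (@cont_t k t x (is_derive_continuous (C1_nneg_derive Ck t0))).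
Qed.

Let cont_grad i x : {for x, continuous (fun z : 'rV[R]_N => w z i / phi z)}.
Proof.
apply: continuousM; first exact: continuous_sub_coord.
by apply: continuousV; [exact: sdist_neq0|exact: continuous_sdist].
Qed.

Let cont_hess i j x :
  {for x, continuous (fun z : 'rV[R]_N => ((i == j)%:R - w z i * w z j / phi z ^+ 2) / phi z)}.
Proof.
have cV : {for x, continuous (fun z : 'rV[R]_N => (phi z)^-1)}.
  by apply: continuousV; [exact: sdist_neq0|exact: continuous_sdist].
apply: (@continuousM _ _ (fun z : 'rV[R]_N => (i == j)%:R - w z i * w z j / phi z ^+ 2)) => //.
apply: continuousB; first exact: cst_continuous.
have -> : (fun z : 'rV[R]_N => w z i * w z j / phi z ^+ 2) =
          (fun z => (w z i / phi z) * (w z j / phi z)).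
  by apply/funext => z; field; exact: sdist_neq0.
by apply: continuousM; exact: cont_grad.
Qed.

Lemma C12_barrier : C12_pos barrier.
Proof.
split.
- by move=> t x t0; apply: continuous_barrier; exact: ltW.
- by move=> t x t0; have [] := is_derive_barrier_t x (ltW t0).
- move=> t x t0; have t0' := ltW t0.
  have E : {near (t, x), (fun z : R * 'rV[R]_N =>
      b' z.1 * G (zeta z.1 z.2) + b z.1 * (G1 (zeta z.1 z.2) * a' z.1) + k' z.1)
      =1 (fun z => partial_t barrier z.1 z.2)}.
    have : \forall z \near (t, x), 0 < z.1 :> R.
      exists ([set s : R | 0 < s], [set: 'rV[R]_N]); last by move=> z [].
      by split; [exact: lt_nbhsr|exact: filterT].
    apply: filterS => z z0; rewrite /partial_t derive1E.
    by have [_ ->] := is_derive_barrier_t z.2 (ltW z0).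
  have C : {for (t, x), continuous (fun z : R * 'rV[R]_N =>
      b' z.1 * G (zeta z.1 z.2) + b z.1 * (G1 (zeta z.1 z.2) * a' z.1) + k' z.1)}.
    apply: continuousD; last exact: (@cont_t k' t x (C1_nneg_cont Ck t0')).
    apply: continuousD.
      by apply: continuousM; [exact: (@cont_t b' t x (C1_nneg_cont Cb t0'))|exact: cont_zeta].
    apply: continuousM; first exact: (@cont_t b t x (cb t0')).
    by apply: continuousM; [exact: cont_zeta|exact: (@cont_t a' t x (C1_nneg_cont Ca t0'))].
  rewrite /prop_for /continuous_at.
  rewrite -(nbhs_singleton E); apply: cvg_trans C.
  exact: near_eq_cvg.
- by move=> i t x t0; have [] := is_derive_barrier_x t x i.
- move=> i t x /ltW t0.
  have -> : (fun z : R * 'rV[R]_N => partial i (barrier z.1) z.2) =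
     (fun z => - (b z.1 * G1 (zeta z.1 z.2)) * (w z.2 i / phi z.2)).
    by apply/funext => z; rewrite partial_barrier.
  apply: continuousM; last exact: (@cont_x (fun z : 'rV[R]_N => w z i / phi z)).
  apply: continuousN; apply: continuousM; first by exact: (@cont_t b t x (cb t0)).
  exact: cont_zeta.
- by move=> i j t x t0; have [] := is_derive_barrier_xx t x i j.
- move=> i j t x /ltW t0.
  have -> : (fun z : R * 'rV[R]_N => partial j (partial i (barrier z.1)) z.2) =
     (fun z => b z.1 * G2 (zeta z.1 z.2) * (w z.2 i / phi z.2) * (w z.2 j / phi z.2)
     - b z.1 * G1 (zeta z.1 z.2) *
       (((i == j)%:R - w z.2 i * w z.2 j / phi z.2 ^+ 2) / phi z.2)).
    apply/funext => z; rewrite {1}/partial.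
    by have [_ ->] := is_derive_barrier_xx z.1 z.2 i j.
  apply: continuousB.
    apply: continuousM; last exact: (@cont_x (fun z : 'rV[R]_N => w z j / phi z)).
    apply: continuousM; last exact: (@cont_x (fun z : 'rV[R]_N => w z i / phi z)).
    apply: continuousM; first by exact: (@cont_t b t x (cb t0)).
    exact: (@cont_zeta G2 t x t0 (C2_profile_cont CG)).
  apply: continuousM; last exact: (@cont_x (fun z : 'rV[R]_N => ((i == j)%:R - w z i * w z j / phi z ^+ 2) / phi z)).
  by apply: continuousM; [exact: (@cont_t b t x (cb t0))|exact: cont_zeta].
Qed.

Lemma grad_barrier t x :
  grad (barrier t) x = (- (b t * G1 (zeta t x)) / phi x) *: (x - y).
Proof. by apply/rowP => i; rewrite !mxE partial_barrier !mxE; ring. Qed.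

Lemma enorm_grad_barrier (t : R) x : 0 <= t ->
  enorm (grad (barrier t) x) = b t * `|G1 (zeta t x)| * (enorm (x - y) / phi x).
Proof.
move=> t0; rewrite grad_barrier enormZ normrM normrN normrM.
have P0 : 0 < (phi x)^-1 by rewrite invr_gt0 sdist_gt0.
rewrite (gtr0_norm (b_gt0 t0)) (gtr0_norm P0).
by ring.
Qed.

(** This is |grad phi|. *)
Definition slope x : R := enorm (x - y) / phi x.

(** The divergence of |grad phi|^(p-2) grad phi, i.e. the contribution of the
    curvature of the level sets of phi. *)
Definition flux_div x : R :=
  slope x `^ (p - 2) * (N%:R + (p - 2) - (p - 1) * slope x ^+ 2) / phi x.

Let m0 : 0 < p - 2. Proof. by rewrite subr_gt0. Qed.

(** The flux of the barrier factors as
    - b^(p-1) (|G'|^(p-2) G')(a - phi) |grad phi|^(p-2) grad phi; its divergence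
    splits into the one-dimensional flux derivative along the gradient and the
    curvature term. *)
Lemma p_laplacian_barrier (t : R) x : 0 <= t ->
  p_laplacian p (barrier t) x =
  b t `^ (p - 1) * (H1 (zeta t x) * slope x `^ (p - 2) * slope x ^+ 2
    - `|G1 (zeta t x)| `^ (p - 2) * G1 (zeta t x) * flux_div x).
Proof.
move=> t0; have bt0 := b_gt0 t0.
have bE : b t `^ (p - 1) = b t `^ (p - 2) * b t.
  have -> : p - 1 = p - 2 + 1 by ring.
  exact: powR_succ.
have VE i : (fun z => (enorm (grad (barrier t) z) `^ (p - 2) *:
      grad (barrier t) z) 0 i) =
    (fun z => - b t `^ (p - 1) * ((`|G1 (zeta t z)| `^ (p - 2) * G1 (zeta t z)) *
       (phi z `^ (- (p - 1)) * (enorm (z - y) `^ (p - 2) * w z i)))).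
  apply/funext => z; have P0 := sdist_gt0 y K0 z.
  have iP : 0 <= (phi z)^-1 by rewrite invr_ge0 ltW.
  have bG : 0 <= b t * `|G1 (zeta t z)| by rewrite mulr_ge0// ltW.
  rewrite mxE enorm_grad_barrier// (powRM _ bG) ?mulr_ge0 ?enorm_ge0//.
  rewrite (powRM _ (ltW bt0))// (powRM _ _ iP) ?enorm_ge0//.
  rewrite grad_barrier mxE bE.
  have -> : - (p - 1) = - (p - 2) - 1 by ring.
  by rewrite (powR_pred _ P0) powRVN ?(ltW P0)//; ring.
have D i := is_derive_scale (- b t `^ (p - 1)) (is_derive_mul
    (is_derive_comp_zeta t x i (C2_profile_flux CG))
    (is_derive_mul (is_derive_powR (- (p - 1)) (sdist_gt0 y K0 x)
        (is_derive_sdist y K0 x i))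
      (is_derive_powR_enorm_coord y x i m0))).
rewrite /p_laplacian /divergence.
under eq_bigr => i _ do rewrite VE /partial (@derive_val _ _ _ _ _ _ _ (D i)).
have P0 := sdist_gt0 y K0 x.
have eP : phi x `^ (- (p - 1)) = phi x `^ (- (p - 2)) / phi x.
  by rewrite -powR_pred//; congr powR; ring.
have eP1 : phi x `^ (- (p - 1) - 1) = phi x `^ (- (p - 2)) / phi x ^+ 2.
  by rewrite powR_pred// eP; field; rewrite gt_eqF.
rewrite eP eP1 /flux_div.
have -> : slope x `^ (p - 2) = enorm (x - y) `^ (p - 2) * phi x `^ (- (p - 2)).
  rewrite powRM ?enorm_ge0 ?invr_ge0 ?(ltW P0)//; congr (_ * _).
  by rewrite powRVN ?ltW.
rewrite /slope; set W := enorm (x - y); set P := phi x in P0 *.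
set Wm := W `^ _; set Pm := P `^ _; set HH := _ * G1 _; set bb := b t `^ _.
set h1 := H1 _.
pose c0 := - bb * HH * Pm / P * Wm.
pose c1 := - bb * (HH * (Wm * Pm / P * (p - 2) * W ^- 2
   - Wm * Pm * (p - 1) / P ^+ 3) - h1 * Pm * Wm / P ^+ 2).
have sW : \sum_(i < N) w x i ^+ 2 = W ^+ 2 by rewrite enorm_sqr.
transitivity (\sum_(i < N) (c0 + c1 * w x i ^+ 2)).
  apply: eq_bigr => i _; rewrite /c0 /c1 -(exprVn W) exprMn.
  by move: (W^-1) => V; field; rewrite gt_eqF.
rewrite big_split/= sumr_const card_ord -mulr_natr -mulr_sumr sW /c0 /c1.
have [W0|W0] := eqVneq W 0.
  have -> : Wm = 0 by rewrite /Wm W0 powR0// gt_eqF.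
  by ring.
by field; rewrite W0 gt_eqF.
Qed.

Lemma pde_lhs_barrier (t : R) x : 0 <= t ->
  pde_lhs p barrier t x =
  b' t * G (zeta t x) + b t * (G1 (zeta t x) * a' t) + k' t
  - b t `^ (p - 1) * (H1 (zeta t x) * slope x `^ (p - 2) * slope x ^+ 2
    - `|G1 (zeta t x)| `^ (p - 2) * G1 (zeta t x) * flux_div x)
  + (b t * `|G1 (zeta t x)| * slope x) `^ (p - 1).
Proof.
move=> t0; rewrite /pde_lhs p_laplacian_barrier// enorm_grad_barrier//.
by rewrite /partial_t derive1E (@derive_val _ _ _ _ _ _ _ (is_derive_barrier_t x t0)).
Qed.

Lemma slope_ge0 x : 0 <= slope x.
Proof. by rewrite divr_ge0 ?enorm_ge0// ltW// sdist_gt0. Qed.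

Lemma slope_le1 x : slope x <= 1.
Proof. by rewrite ler_pdivrMr ?sdist_gt0// mul1r sdist_ge_enorm. Qed.

Lemma slope_sqr x : slope x ^+ 2 = 1 - (K / phi x) ^+ 2.
Proof.
have P0 := sdist_neq0 y K0 x.
have E : K ^+ 2 = phi x ^+ 2 - enorm (x - y) ^+ 2 by rewrite sdist_sqr; ring.
by rewrite /slope !expr_div_n E; field.
Qed.

(** Bounded below by ((N-1)/phi) slope^(p-2), hence the condition on N. *)
Lemma flux_div_ge0 x : (1 <= N)%N -> 0 <= flux_div x.
Proof.
move=> N1; rewrite divr_ge0 ?(ltW (sdist_gt0 y K0 x))// mulr_ge0 ?powR_ge0//.
have N1' : 1 <= N%:R :> R by rewrite ler1n.
have q1 : slope x ^+ 2 <= 1 by rewrite expr_le1 ?slope_ge0// slope_le1.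
by have := p2; nra.
Qed.

Lemma flux_div_le x : flux_div x <= (N%:R + (p - 2)) / K.
Proof.
have P0 := sdist_gt0 y K0 x.
have q1 : slope x `^ (p - 2) <= 1.
  by rewrite powR_le1 ?slope_ge0 ?slope_le1// ltW.
have N0 : 0 <= N%:R :> R by [].
have q0 := sqr_ge0 (slope x); have P1 := sdist_geK y K0 x.
have Ki : 0 <= (phi x)^-1 by rewrite invr_ge0 ltW.
rewrite /flux_div -mulrA; apply: le_trans (_ : (N%:R + (p - 2)) / phi x <= _).
  rewrite mulrA ler_wpM2r//.
  apply: le_trans (_ : slope x `^ (p - 2) * (N%:R + (p - 2)) <= _).
    by rewrite ler_wpM2l ?powR_ge0//; have := p2; nra.
  by rewrite ler_piMl// addr_ge0// ltW.
by apply: ler_wpM2l; [rewrite addr_ge0// ltW|rewrite lef_pV2 ?posrE].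
Qed.

End barrier.

(** * Comparison with smooth barriers *)

Section comparison.
Context {R : realType} {N : nat}.
Implicit Types (t : R) (x : 'rV[R]_N).

Lemma compact_slab (t1 t2 rho : R) :
  compact [set z : R * 'rV[R]_N | t1 <= z.1 <= t2 /\ `|z.2| <= rho].
Proof.
have -> : [set z : R * 'rV[R]_N | t1 <= z.1 <= t2 /\ `|z.2| <= rho] =
    `[t1, t2]%classic `*` [set x : 'rV[R]_N | `|x| <= rho].
  by apply/seteqP; split=> -[t x]; rewrite /= in_itv.
apply: compact_setX; first exact: segment_compact.
apply: bounded_closed_compact.
  exists rho; split; first exact: num_real.
  by move=> M rM x /= xr; rewrite (le_trans xr)// ltW.
have -> : [set x : 'rV[R]_N | `|x| <= rho] = (fun x : 'rV[R]_N => `|x|) @^-1` [set s : R | s <= rho].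
  by [].
by apply: closed_comp; [move=> x _; exact: norm_continuous|exact: closed_le].
Qed.

(** A negative value would give a negative minimum on the compact part of the
    slab; the sign conditions on the boundary push the minimizer into the open
    slab, where it is a local minimum in the full neighbourhood filter that the
    definition of viscosity solutions asks for. *)
Lemma slab_min_principle (g : R * 'rV[R]_N -> R) (t1 t2 rho : R) :
  {within [set z | t1 <= z.1], continuous g} ->
  (forall x, 0 <= g (t1, x)) -> (forall x, 0 <= g (t2, x)) ->
  (forall t x, t1 <= t <= t2 -> rho <= `|x| -> 0 <= g (t, x)) ->
  (forall t x, t1 < t < t2 -> g (t, x) < 0 ->
     (\forall z \near (t, x), g (t, x) <= g z) -> False) ->
  forall t x, t1 <= t <= t2 -> 0 <= g (t, x).
Proof.
move=> cg g1 g2 gr gloc t x tt; rewrite leNgt; apply/negP => gtx.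
pose S := [set z : R * 'rV[R]_N | t1 <= z.1 <= t2 /\ `|z.2| <= rho].
have Sin s z : t1 <= s <= t2 -> g (s, z) < 0 -> S (s, z).
  move=> st gs; split => //=; rewrite leNgt; apply/negP => /ltW h.
  by have := gr s z st h; rewrite leNgt gs.
have cS : {within S, continuous g}.
  by apply: continuous_subspaceW cg => -[s z] /= [/andP[]].
have S0 : S !=set0 by exists (t, x); exact: Sin.
have [[s z] + smin] := compact_EVT_min S0 (@compact_slab t1 t2 rho) cS.
rewrite inE => -[/= st zr].
have gsz : g (s, z) < 0.
  by apply: (le_lt_trans _ gtx); apply: smin; apply/mem_set; exact: (Sin _ _ tt gtx).
have s1 : t1 < s.
  rewrite lt_def; case/andP: (st) => -> _; rewrite andbT.
  by apply: contraTneq gsz => ->; rewrite -leNgt.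
have s2 : s < t2.
  rewrite lt_def; case/andP: (st) => _ ->; rewrite andbT.
  by apply: contraTneq gsz => <-; rewrite -leNgt.
apply: (gloc s z); rewrite ?s1//.
have : \forall w \near (s, z), t1 < w.1 < t2.
  exists ([set r : R | t1 < r < t2], [set: 'rV[R]_N]); last by move=> w [].
  split; last exact: filterT.
  by near=> r; apply/andP; split; near: r; [exact: lt_nbhsr|exact: lt_nbhsl].
apply: filterS => -[r w] /= /andP[r1 r2].
have [gw|gw] := ltP (g (r, w)) 0; last by rewrite ltW// (lt_le_trans gsz).
apply: smin; apply/mem_set; apply: Sin => //; by rewrite (ltW r1) ltW.
Unshelve. all: by end_near. Qed.

Variables (p : R) (u : R -> 'rV[R]_N -> R) (f : R -> 'rV[R]_N -> R).
Hypothesis cu : {within [set z : R * 'rV[R]_N | 0 <= z.1],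
    continuous (fun z => u z.1 z.2)}.
Hypothesis cf : forall t x, 0 <= t ->
  {for (t, x), continuous (fun z : R * 'rV[R]_N => f z.1 z.2)}.
Hypothesis Cf : C12_pos f.
Variables (t1 t2 rho : R).
Hypothesis t10 : 0 <= t1.

Let cuf : {within [set z : R * 'rV[R]_N | t1 <= z.1],
    continuous (fun z => u z.1 z.2 - f z.1 z.2)}.
Proof.
have H : {within [set z : R * 'rV[R]_N | t1 <= z.1], continuous (fun z => u z.1 z.2)}.
  apply: continuous_subspaceW cu => z /= h; exact: le_trans h.
have H' : {within [set z : R * 'rV[R]_N | t1 <= z.1], continuous (fun z => f z.1 z.2)}.
  apply: continuous_in_subspaceT => -[t x]; rewrite inE/= => h.
  apply: cf; exact: le_trans h.
by move=> z; apply: continuousB; [exact: H|exact: H'].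
Qed.

(** The differential inequality is asked only where f exceeds u, so that the
    barriers may fail to be subsolutions where they are small. *)
Lemma comparison_below : viscosity_supersolution p u ->
  (forall x, f t1 x <= u t1 x) -> (forall x, f t2 x <= u t2 x) ->
  (forall t x, t1 <= t <= t2 -> rho <= `|x| -> f t x <= u t x) ->
  (forall t x, t1 < t < t2 -> u t x < f t x -> pde_lhs p f t x < 0) ->
  forall t x, t1 <= t <= t2 -> f t x <= u t x.
Proof.
move=> su h1 h2 hr hs t x tt; rewrite -subr_ge0.
apply: (slab_min_principle (g := fun z => u z.1 z.2 - f z.1 z.2) cuf (rho := rho) (t2 := t2)) => //.
- by move=> z; rewrite subr_ge0.
- by move=> z; rewrite subr_ge0.
- by move=> s z st zr; rewrite subr_ge0 hr.
- move=> s z /[dup] st /andP[s1 s2]; rewrite /= subr_lt0 => ltuf loc.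
  have := su f s z Cf (le_lt_trans t10 s1) loc.
  by rewrite leNgt hs.
Qed.

Lemma comparison_above : viscosity_subsolution p u ->
  (forall x, u t1 x <= f t1 x) -> (forall x, u t2 x <= f t2 x) ->
  (forall t x, t1 <= t <= t2 -> rho <= `|x| -> u t x <= f t x) ->
  (forall t x, t1 < t < t2 -> f t x < u t x -> 0 < pde_lhs p f t x) ->
  forall t x, t1 <= t <= t2 -> u t x <= f t x.
Proof.
move=> su h1 h2 hr hs t x tt; rewrite -subr_ge0.
apply: (slab_min_principle (g := fun z => f z.1 z.2 - u z.1 z.2) (rho := rho) (t1 := t1) (t2 := t2)) => //.
- have -> : (fun z : R * 'rV[R]_N => f z.1 z.2 - u z.1 z.2) =
    - (fun z => u z.1 z.2 - f z.1 z.2).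
    by apply/funext => z; rewrite [RHS]opprB.
  by move=> z; apply: continuousN; exact: cuf.
- by move=> z; rewrite subr_ge0.
- by move=> z; rewrite subr_ge0.
- by move=> s z st zr; rewrite subr_ge0 hr.
- move=> s z /[dup] st /andP[s1 s2]; rewrite /= subr_lt0 => ltuf loc.
  have : \forall w \near (s, z), u w.1 w.2 - f w.1 w.2 <= u s z - f s z.
    by apply: filterS loc => w; rewrite -lerN2 !opprB.
  move=> /(su f s z Cf (le_lt_trans t10 s1)).
  by rewrite leNgt hs.
Qed.

End comparison.

(** * The smooth positive part and its powers *)

Section regularized_positive_part.
Context {R : realType}.
Variable eta : R.
Hypothesis eta0 : 0 < eta.
Implicit Types z : R.

Definition hypot z : R := Num.sqrt (eta ^+ 2 + z ^+ 2).
(** A globally smooth and strictly positive substitute for max(z, 0), with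
    derivative [pospart z / hypot z]. *)
Definition pospart z : R := (z + hypot z) / 2.
Local Notation S := hypot.
Local Notation L := pospart.

Lemma hypot_sqr z : S z ^+ 2 = eta ^+ 2 + z ^+ 2.
Proof. by rewrite sqr_sqrtr// addr_ge0 ?sqr_ge0. Qed.

Lemma hypot_gt0 z : 0 < S z.
Proof. by rewrite sqrtr_gt0 ltr_pwDl ?exprn_gt0 ?sqr_ge0. Qed.

Lemma hypot_ge_eta z : eta <= S z.
Proof.
rewrite -ler_sqr ?nnegrE ?(ltW eta0) ?(ltW (hypot_gt0 _))// hypot_sqr.
by rewrite lerDl sqr_ge0.
Qed.

Lemma norm_lt_hypot z : `|z| < S z.
Proof.
rewrite -ltr_sqr ?nnegrE ?(ltW (hypot_gt0 _))// hypot_sqr real_normK ?num_real//.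
by rewrite ltrDr exprn_gt0.
Qed.

Lemma hypot_le z : S z <= `|z| + eta.
Proof.
rewrite -ler_sqr ?nnegrE ?(ltW (hypot_gt0 _)) ?addr_ge0 ?(ltW eta0)//.
have ze := mulr_ge0 (normr_ge0 z) (ltW eta0).
by rewrite hypot_sqr sqrrD real_normK ?num_real// mulr2n; lra.
Qed.

Lemma pospart_gt0 z : 0 < L z.
Proof.
rewrite divr_gt0// -ltrBlDl sub0r; apply: le_lt_trans (norm_lt_hypot z).
by rewrite -normrN ler_norm.
Qed.

Lemma pospart_le_hypot z : L z <= S z.
Proof.
have := le_lt_trans (ler_norm z) (norm_lt_hypot z).
by rewrite /L; lra.
Qed.

Lemma pospart_ge z : z <= L z.
Proof.
have := le_lt_trans (ler_norm z) (norm_lt_hypot z).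
by rewrite /L; lra.
Qed.

Lemma pospart_le z : L z <= Num.max z 0 + eta.
Proof.
have := hypot_le z; have e0 := eta0; rewrite /L.
have [z0|z0] := leP z 0; [rewrite ler0_norm//|rewrite gtr0_norm//];
  rewrite ?(max_l (ltW z0)) ?(max_r z0); lra.
Qed.

Lemma pospart_hypot_gap z : L z * (S z - L z) = eta ^+ 2 / 4.
Proof.
have -> : eta ^+ 2 = S z ^+ 2 - z ^+ 2 by rewrite hypot_sqr; ring.
by rewrite /L; field.
Qed.

Lemma is_derive_hypot z : is_derive z 1 S (z / S z).
Proof.
have p0 : 0 < eta ^+ 2 + z * z by rewrite -expr2 ltr_pwDl ?exprn_gt0 ?sqr_ge0.
have := is_derive_sqrt (f := fun z => eta ^+ 2 + z * z) p0 (is_derive_add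
  (is_derive_const (eta ^+ 2) _ _) (is_derive_mul (is_derive_id z 1) (is_derive_id z 1))).
have -> : (fun y : R => Num.sqrt (eta ^+ 2 + y * y)) = S.
  by apply/funext => y; rewrite -expr2.
move=> H; apply: (is_derive_eq H).
rewrite -expr2 -/(S z); have := hypot_gt0 z => S0.
by field; rewrite gt_eqF.
Qed.

Lemma is_derive_pospart z : is_derive z 1 L (L z / S z).
Proof.
have := is_derive_scale 2^-1 (is_derive_add (is_derive_id z 1) (is_derive_hypot z)).
have -> : (fun y : R => 2^-1 * (id y + S y)) = L.
  by apply/funext => y; rewrite mulrC.
move=> H; apply: (is_derive_eq H); have S0 := hypot_gt0 z.
by rewrite /L; field; rewrite gt_eqF.
Qed.

End regularized_positive_part.

Section power_profile.
Context {R : realType}.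
Variables (eta p : R).
Hypotheses (eta0 : 0 < eta) (p2 : 2 < p).
Implicit Types z : R.
Local Notation S := (hypot eta).
Local Notation L := (pospart eta).
Local Notation g := ((p - 1) / (p - 2)).

Definition profile z : R := L z `^ g.
Definition profile1 z : R := g * profile z / S z.
Definition profile2 z : R := profile1 z / S z * (g - z / S z).
Definition profile_flux1 z : R :=
  (p - 1) * (`|profile1 z| `^ (p - 2) * profile1 z) / S z * (g - z / S z).

Let m0 : 0 < p - 2. Proof. by rewrite subr_gt0. Qed.
Let p1 : 0 < p - 1. Proof. by have := p2; lra. Qed.
Let g0 : 0 < g. Proof. by rewrite divr_gt0. Qed.

Lemma profile_gt0 z : 0 < profile z.
Proof. by rewrite powR_gt0// pospart_gt0. Qed.

Lemma profile1_gt0 z : 0 < profile1 z.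
Proof. by rewrite divr_gt0 ?hypot_gt0// mulr_gt0 ?profile_gt0. Qed.

Lemma is_derive_power_profile z : is_derive z 1 profile (profile1 z).
Proof.
have L0 := pospart_gt0 eta0 z; have S0 := hypot_gt0 eta0 z.
have := is_derive_powR (f := L) g L0 (is_derive_pospart eta0 z).
move=> H; apply: (is_derive_eq H).
rewrite powR_pred// /profile1 /profile; field.
by rewrite !gt_eqF.
Qed.

Lemma is_derive_power_profile1 z : is_derive z 1 profile1 (profile2 z).
Proof.
have S0 := hypot_gt0 eta0 z; have S1 : S z != 0 by rewrite gt_eqF.
have := is_derive_div (f := fun z => g * profile z) (g := S) S1
  (is_derive_scale g (is_derive_power_profile z)) (is_derive_hypot eta0 z).
move=> H; apply: (is_derive_eq H).
rewrite /profile2 /profile1; field.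
by rewrite S1 gt_eqF.
Qed.

Lemma C2_power_profile : C2_profile (p - 2) profile profile1 profile2 profile_flux1.
Proof.
split; first exact: is_derive_power_profile.
- exact: is_derive_power_profile1.
- have cS z : {for z, continuous (fun z => (S z)^-1)}.
    apply: continuousV; first by rewrite gt_eqF// hypot_gt0.
    exact: is_derive_continuous (is_derive_hypot eta0 z).
  have c1 z : {for z, continuous profile1}.
    exact: is_derive_continuous (is_derive_power_profile1 z).
  move=> z; apply: (@continuousM _ _ (fun z => profile1 z / S z)
    (fun z => g - z / S z)).
    exact: (@continuousM _ _ profile1 (fun z => (S z)^-1) _ (c1 z) (cS z)).
  apply: continuousB; first exact: cst_continuous.
  exact: (@continuousM _ _ id (fun z => (S z)^-1) _ cvg_id (cS z)).
- move=> z; have P0 := profile1_gt0 z; have S0 := hypot_gt0 eta0 z.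
  have := is_derive_mul (is_derive_powR (p - 2) P0 (is_derive_power_profile1 z))
    (is_derive_power_profile1 z).
  have -> : (fun y => profile1 y `^ (p - 2) * profile1 y) =
    (fun y => `|profile1 y| `^ (p - 2) * profile1 y).
    by apply/funext => y; rewrite (gtr0_norm (profile1_gt0 y)).
  move=> H; apply: (is_derive_eq H).
  rewrite powR_pred// /profile_flux1 /profile2 gtr0_norm//.
  by field; rewrite !gt_eqF.
Qed.

(** With l = L / S the derivative of L, the exponent (p-1)/(p-2) is the one for
    which the flux is again the profile, up to a constant and the factor
    l^(p-1).  This is why absorption and decay of the amplitude balance. *)
Lemma power_profile_flux z :
  (`|profile1 z| `^ (p - 2) * profile1 z) =
  g `^ (p - 1) * (profile z * (L z / S z) `^ (p - 1)).
Proof.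
have P0 := profile1_gt0 z; have S0 := hypot_gt0 eta0 z.
have L0 := pospart_gt0 eta0 z.
rewrite gtr0_norm// -powR_succ//.
have -> : p - 2 + 1 = p - 1 by ring.
have iS : 0 <= (S z)^-1 by rewrite invr_ge0 ltW.
have G0 := profile_gt0 z.
rewrite /profile1 (powRM _ _ iS) ?(powRM _ (ltW g0) (ltW G0)); last first.
  by rewrite mulr_ge0 ?ltW.
rewrite (powRM _ (ltW L0) iS) -mulrA; congr (_ * _); rewrite mulrA; congr (_ * _).
rewrite /profile -powRrM -powRD ?(gt_eqF L0) ?implybT//; congr powR.
by field; rewrite gt_eqF.
Qed.

End power_profile.

(** * Amplitude, front and terminal correction *)

Section time_coefficients.
Context {R : realType}.
Variables (p Lam th tau : R).
Hypotheses (p2 : 2 < p) (Lam0 : 0 < Lam) (tau0 : 0 < tau).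
Implicit Types t : R.
Local Notation g := ((p - 1) / (p - 2)).

(** With g = (p-1)/(p-2), the amplitude b solves b' = - Lam (g b)^(p-1) and the
    front a solves a' = th g^(p-1) b^(p-2); the exact planar solution is
    Lam = th = 1. *)
Definition height t : R := ((p - 2) * Lam * g `^ (p - 1) * (t + tau)) `^ (- (p - 2)^-1).
Definition height1 t : R := - (height t / ((p - 2) * (t + tau))).
Definition front (alpha : R) t : R := alpha + th / (Lam * (p - 2)) * ln (t + tau).
Definition front1 t : R := th / (Lam * (p - 2) * (t + tau)).

Let m0 : 0 < p - 2. Proof. by rewrite subr_gt0. Qed.
Let p1 : 0 < p - 1. Proof. by have := p2; lra. Qed.
Let g0 : 0 < g. Proof. by rewrite divr_gt0. Qed.
Let c0 : 0 < (p - 2) * Lam * g `^ (p - 1).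
Proof. by rewrite !mulr_gt0// powR_gt0. Qed.
Let s0 t : 0 <= t -> 0 < t + tau. Proof. by have := tau0; lra. Qed.

Lemma height_gt0 t : 0 <= t -> 0 < height t.
Proof. by move=> t0; rewrite powR_gt0// mulr_gt0// s0. Qed.

Lemma heightE t : 0 <= t ->
  height t `^ (p - 1) * g `^ (p - 1) = height t / ((p - 2) * Lam * (t + tau)).
Proof.
move=> t0; have b0 := height_gt0 t0; have t0' := s0 t0.
have -> : height t `^ (p - 1) = height t `^ (p - 2) * height t.
  by rewrite -powR_succ//; congr powR; ring.
have -> : height t `^ (p - 2) = ((p - 2) * Lam * g `^ (p - 1) * (t + tau))^-1.
  rewrite -powRrM mulNr mulVf ?gt_eqF// powR_inv1//.
  by rewrite ltW// mulr_gt0.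
have G0 : 0 < g `^ (p - 1) by rewrite powR_gt0.
by move: (g `^ (p - 1)) G0 => G G0; field; rewrite !gt_eqF.
Qed.

Let is_derive_affine t : is_derive t 1 (fun t => t + tau) 1.
Proof.
apply: (is_derive_eq (is_derive_add (is_derive_id t 1) (is_derive_const tau t 1))).
by rewrite addr0.
Qed.

Let cont_inv t : 0 <= t -> {for t, continuous (fun t => (t + tau)^-1)}.
Proof.
move=> t0; apply: continuousV; first by rewrite gt_eqF// s0.
exact: is_derive_continuous (is_derive_affine t).
Qed.

Lemma C1_height : C1_nneg height height1.
Proof.
have D t : 0 <= t -> is_derive t 1 height (height1 t).
  move=> t0; have t0' := s0 t0.
  have P : 0 < (p - 2) * Lam * g `^ (p - 1) * (t + tau) by rewrite mulr_gt0.
  have H := is_derive_powR (f := fun t => (p - 2) * Lam * g `^ (p - 1) * (t + tau))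
     (- (p - 2)^-1) P (is_derive_scale _ (is_derive_affine t)).
  apply: (is_derive_eq H); rewrite powR_pred// /height1 /height.
  move: ((_ * (t + tau)) `^ _) => Q.
  have G0 : 0 < g `^ (p - 1) by rewrite powR_gt0.
  by move: (g `^ (p - 1)) G0 => G G0; field; rewrite !gt_eqF.
split=> // t t0.
have -> : height1 = (fun t => - (height t * ((p - 2)^-1 * (t + tau)^-1))).
  by apply/funext => s; rewrite /height1 invfM.
apply: continuousN; apply: continuousM; first exact: is_derive_continuous (D t t0).
by apply: continuousM; [exact: cst_continuous|exact: cont_inv].
Qed.

Lemma C1_front alpha : C1_nneg (front alpha) front1.
Proof.
split=> t t0; have t0' := s0 t0.
  have H := is_derive_add (is_derive_const alpha t 1) (is_derive_scale
     (th / (Lam * (p - 2))) (is_derive_comp1 (g := fun t => t + tau)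
      (is_derive1_ln t0') (is_derive_affine t))).
  by apply: (is_derive_eq H); rewrite /front1; field; rewrite !gt_eqF.
have -> : front1 = (fun t => th / (Lam * (p - 2)) * (t + tau)^-1).
  by apply/funext => s; rewrite /front1 invfM mulrA.
by apply: continuousM; [exact: cst_continuous|exact: cont_inv].
Qed.

(** At most [d] up to time [T], and as large as needed at time 2 T when [lam] is
    large. *)
Definition ramp (d lam T t : R) : R := d * expR (lam * (t - T)).

Lemma C1_ramp (d lam T : R) : C1_nneg (ramp d lam T) (fun t => lam * ramp d lam T t).
Proof.
have D t : is_derive t 1 (ramp d lam T) (lam * ramp d lam T t).
  have H := is_derive_scale d (is_derive_comp1 (g := fun t => lam * (t - T))
    (is_derive_expR _) (is_derive_scale lam (is_derive_sub (is_derive_id t 1)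
       (is_derive_const T t 1)))).
  by apply: (is_derive_eq H); rewrite /ramp; ring.
split=> // t t0; apply: continuousM; first exact: cst_continuous.
exact: is_derive_continuous (D t).
Qed.

End time_coefficients.

(** * The equation on the barriers *)

Section power_barrier.
Context {R : realType} {N : nat}.
Variables (p Lam th tau alpha d lam T eta K : R) (y : 'rV[R]_N).
Hypotheses (p2 : 2 < p) (Lam0 : 0 < Lam) (tau0 : 0 < tau)
  (eta0 : 0 < eta) (K0 : 0 < K).
Local Notation g := ((p - 1) / (p - 2)).
Local Notation S := (hypot eta).
Local Notation L := (pospart eta).
Local Notation b := (height p Lam tau).
Local Notation a := (front p Lam th tau alpha).
Local Notation zeta t x := (a t - sdist K y x).

Definition power_barrier : R -> 'rV[R]_N -> R :=
  barrier b a (ramp d lam T) (profile eta p) K y.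

Lemma power_barrierE t x :
  power_barrier t x = b t * L (zeta t x) `^ g + ramp d lam T t.
Proof. by []. Qed.

Lemma C12_power_barrier : C12_pos power_barrier.
Proof.
exact: (C12_barrier y K0 (C1_height p2 Lam0 tau0) (C1_front th p2 Lam0 tau0 alpha)
  (C1_ramp d lam T) (C2_power_profile eta0 p2)).
Qed.

Lemma continuous_power_barrier (t : R) x : 0 <= t ->
  {for (t, x), continuous (fun z : R * 'rV[R]_N => power_barrier z.1 z.2)}.
Proof.
move=> t0; rewrite /power_barrier.
exact: (continuous_barrier (C1_height p2 Lam0 tau0)
  (C1_front th p2 Lam0 tau0 alpha) (C1_ramp d lam T)
  (C2_power_profile eta0 p2)).
Qed.

(** For l = q = 1 and Lam = th = 1 only the curvature term flux_div survives in
    the bracket, which is the exactness of the planar solution. *)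
Lemma pde_lhs_power_barrier (t : R) x : 0 <= t ->
  let z := zeta t x in let l := L z / S z in let q := slope K y x in
  pde_lhs p power_barrier t x = lam * ramp d lam T t +
  b t / ((p - 2) * Lam * (t + tau)) * L z `^ g *
   (th * g / S z - Lam - l `^ (p - 1) * ((g + 2 * (p - 1) * (1 - l)) *
     (q `^ (p - 2) * q ^+ 2) / S z - flux_div p K y x - q `^ (p - 1))).
Proof.
move=> t0 z l q; have s0 : 0 < t + tau by have := tau0; lra.
have S0 := hypot_gt0 eta0 z; have m0 : 0 < p - 2 by rewrite subr_gt0.
have P0 := profile1_gt0 eta0 p2 z.
have q0 : 0 <= q := slope_ge0 y K0 x.
have b0 := height_gt0 p2 Lam0 tau0 t0.
rewrite (pde_lhs_barrier y p2 K0 (C1_height p2 Lam0 tau0)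
  (C1_front th p2 Lam0 tau0 alpha)
  (C1_ramp d lam T) (C2_power_profile eta0 p2))//; last first.
  by move=> s; exact: height_gt0.
rewrite -/z -/q -/l.
have H := power_profile_flux eta0 p2 z; have HB := heightE p2 Lam0 tau0 t0.
rewrite /profile_flux1 -/g.
have -> : (b t * `|profile1 eta p z| * q) `^ (p - 1) =
   b t `^ (p - 1) * (`|profile1 eta p z| `^ (p - 2) * profile1 eta p z) * q `^ (p - 1).
  rewrite (powRM _ _ q0) ?mulr_ge0 ?(ltW b0)// powRM ?(ltW b0)//.
  rewrite gtr0_norm// -(powR_succ _ P0); congr (_ * _ `^ _ * _); ring.
rewrite H -/l.
have -> : b t `^ (p - 1) =
  b t / ((p - 2) * Lam * (t + tau)) / g `^ (p - 1).
  by rewrite -HB mulfK// gt_eqF// powR_gt0// divr_gt0//; have := p2; lra.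
have g0 : g `^ (p - 1) != 0.
  by rewrite gt_eqF// powR_gt0// divr_gt0//; have := p2; lra.
have zE : z / S z = 2 * l - 1.
  by rewrite /l /pospart; field; rewrite gt_eqF.
rewrite zE /height1 /front1 /profile1 -/(L z `^ g) /profile.
move: (g `^ (p - 1)) g0 => gg gg0.
move: (l `^ (p - 1)) (q `^ (p - 1)) (q `^ (p - 2)) (L z `^ g) (flux_div _ _ _ _).
move: (b t) (ramp _ _ _ _) b0 => bt rt b0 l1 q1 q2 G E.
by field; rewrite gg0 !gt_eqF.
Qed.

End power_barrier.

Section absorption_estimates.
Context {R : realType}.
Variable p : R.
Hypothesis p2 : 2 < p.
Local Notation g := ((p - 1) / (p - 2)).

Lemma powR_near1 (s e : R) : 0 < e -> exists2 d, 0 < d &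
  forall r, 1 - d <= r -> r <= 1 -> 1 - e <= r `^ s.
Proof.
move=> e0; have C := is_derive_continuous (is_derive1_powR s (@ltr01 R)).
have /cvgrPdist_lt /(_ e e0) [d /= d0 H] := C.
exists (d / 2); first by rewrite divr_gt0.
move=> r rd r1; have B : `|1 - r| < d by rewrite ger0_norm ?subr_ge0//; lra.
have /ltW := H r B; rewrite powR1 ler_norml => /andP[_].
by rewrite lerBlDr lerBlDl.
Qed.


Lemma powR_small (s e : R) : 0 < s -> 0 < e ->
  exists2 c, 0 < c <= 1 & c `^ s <= e.
Proof.
move=> s0 e0; exists (Num.min 1 (e `^ s^-1)).
  by rewrite lt_min ltr01 powR_gt0//= ge_min lexx.
have e1 : 0 < e `^ s^-1 by rewrite powR_gt0.
rewrite [leRHS](_ : e = (e `^ s^-1) `^ s); last first.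
  by rewrite -powRrM mulVf ?gt_eqF// powRr1// ltW.
apply: ge0_ler_powR; rewrite ?nnegrE ?powR_ge0 ?(ltW s0)//.
  by rewrite le_min ler01 powR_ge0.
by rewrite ge_min lexx orbT.
Qed.

(** The defect 1 - L' of the regularization. *)
Lemma pospart_ratio (eta : R) z : 0 < eta ->
  1 - pospart eta z / hypot eta z = eta ^+ 2 / (4 * hypot eta z * pospart eta z).
Proof.
move=> e0; have S0 := hypot_gt0 e0 z; have L0 := pospart_gt0 e0 z.
have H := pospart_hypot_gap eta z.
have -> : eta ^+ 2 = 4 * (pospart eta z * (hypot eta z - pospart eta z)).
  by rewrite H; field.
by field; rewrite !gt_eqF.
Qed.

Let gE : g = 1 + (p - 2)^-1.
Proof. by field; rewrite gt_eqF// subr_gt0. Qed.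

(** What the barrier with Lam = th = 1 loses because l < 1 and q < 1 tends to 0
    uniformly on bounded ranges of L.  If L is below some small c the factor
    L^((p-1)/(p-2)) is small, and it absorbs the term in (1 - l) / S, which is
    only bounded after multiplication by L.  If L >= c then l is within
    eta^2 / (4 c^2) of 1. *)
Lemma regularization_error (M e : R) : 0 < M -> 0 < e ->
  exists2 eta0 : R, 0 < eta0 & exists2 q0 : R, q0 < 1 &
  forall eta z q, 0 < eta <= eta0 -> q0 <= q -> q <= 1 -> pospart eta z <= M ->
   pospart eta z `^ g *
     (1 - (pospart eta z / hypot eta z) `^ (p - 1) * q `^ (p - 1)
      + 2 * (p - 1) * (1 - pospart eta z / hypot eta z) / hypot eta z) <= e.
Proof.
move=> M0 e0; have m0 : 0 < p - 2 by rewrite subr_gt0.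
have p1 : 0 < p - 1 by have := p2; lra.
have im0 : 0 < (p - 2)^-1 by rewrite invr_gt0.
have g0 : 0 < g by rewrite divr_gt0.
have pe : 0 < e / (1 + (p - 1)) by rewrite divr_gt0// addr_gt0.
have [c /andP[c0 c1] cs] := powR_small im0 pe.
have Mg0 : 0 < M `^ g by rewrite powR_gt0.
have f0 : 0 < e / M `^ g / 2 by rewrite !divr_gt0.
have [d d0 dr] := powR_near1 (p - 1) f0.
(* the first bound serves 1 - l <= d / 2, both together the term in (1 - l) / S *)
pose eta1 := Num.min (c * Num.min 1 d) ((e / M `^ g / 2) / (p - 1) * c ^+ 2).
have eta1_gt0 : 0 < eta1.
  rewrite lt_min; apply/andP; split; first by rewrite mulr_gt0// lt_min ltr01.
  by rewrite mulr_gt0 ?exprn_gt0// divr_gt0.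
exists eta1 => //; exists (Num.max 0 (1 - d / 2)); first by rewrite gt_max ltr01; lra.
move=> eta z q /andP[h0 h1]; rewrite ge_max => /andP[qq q1] q2 zM.
set l := pospart eta z / hypot eta z.
have S0 := hypot_gt0 h0 z; have L0 := pospart_gt0 h0 z.
have LS := pospart_le_hypot h0 z.
have El := pospart_ratio z h0; rewrite -/l in El.
have l0 : 0 < l by rewrite divr_gt0.
have l1 : l <= 1 by rewrite ler_pdivrMr// mul1r.
have GE : pospart eta z `^ g = pospart eta z * pospart eta z `^ (p - 2)^-1.
  by rewrite gE addrC powR_succ// mulrC.
set G := pospart eta z `^ g in GE *; set S := hypot eta z in S0 LS El *.
set L := pospart eta z in L0 LS El GE zM *.
have G0 : 0 < G by rewrite powR_gt0.
have q0 : 0 <= l `^ (p - 1) * q `^ (p - 1) by rewrite mulr_ge0 ?powR_ge0.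
have [Lc|Lc] := ltP L c.
  set A := L `^ (p - 2)^-1 in GE.
  have Ac : A <= c `^ (p - 2)^-1 by rewrite ge0_ler_powR ?nnegrE ?ltW.
  have A0 : 0 < A by rewrite powR_gt0.
  have t2 : G * (2 * (p - 1) * (1 - l) / S) <= A * (p - 1).
    rewrite El GE.
    have -> : L * A * (2 * (p - 1) * (eta ^+ 2 / (4 * S * L)) / S) =
      A * (p - 1) * ((eta / S) ^+ 2 / 2) by field; rewrite !gt_eqF.
    rewrite ler_piMr ?mulr_ge0 ?(ltW A0) ?(ltW p1)//.
    have : (eta / S) ^+ 2 <= 1.
      rewrite expr_le1// ?divr_ge0 ?(ltW h0) ?(ltW S0)//.
      by rewrite ler_pdivrMr// mul1r; exact: hypot_ge_eta.
    by lra.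
  have t1 : G * (1 - l `^ (p - 1) * q `^ (p - 1)) <= A.
    apply: le_trans (_ : G * 1 <= _).
      by rewrite ler_wpM2l ?(ltW G0)//; lra.
    by rewrite mulr1 GE ler_piMl ?(ltW A0)//; lra.
  apply: le_trans (_ : A * (1 + (p - 1)) <= _).
    by rewrite [leLHS]mulrDr [leRHS]mulrDr mulr1; apply: lerD.
  have pp : 0 < 1 + (p - 1) by rewrite addr_gt0.
  rewrite -(ler_pdivlMr _ _ pp). exact: (le_trans Ac cs).
have hc : eta <= c * Num.min 1 d by apply: (le_trans h1); rewrite ge_min lexx.
have hf : eta <= e / M `^ g / 2 / (p - 1) * c ^+ 2.
  by apply: (le_trans h1); rewrite ge_min lexx orbT.
set f := e / M `^ g / 2 in f0 dr hf *.
have m1 : Num.min 1 d <= 1 by rewrite ge_min lexx.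
have md : Num.min 1 d <= d by rewrite ge_min lexx orbT.
have mm0 : 0 < Num.min 1 d by rewrite lt_min ltr01.
have Sc : c <= S by apply: (le_trans Lc).
have lS : 1 - l <= eta ^+ 2 / (4 * c ^+ 2).
  have cL : c ^+ 2 <= S * L by rewrite expr2 ler_pM// ltW.
  have c2 : 0 < c ^+ 2 by rewrite exprn_gt0.
  rewrite El; apply: ler_wpM2l; first exact: sqr_ge0.
  by rewrite lef_pV2 ?posrE; lra.
have ld : 1 - l <= d / 2.
  apply: (le_trans lS); rewrite ler_pdivrMr ?mulr_gt0 ?exprn_gt0//.
  apply: le_trans (_ : (c * Num.min 1 d) ^+ 2 <= _).
    by rewrite ler_sqr ?nnegrE ?(ltW h0)// mulr_ge0 ?(ltW c0)// ltW.
  rewrite exprMn.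
  have -> : d / 2 * (4 * c ^+ 2) = c ^+ 2 * (2 * d) by field.
  by rewrite ler_wpM2l ?sqr_ge0//; nra.
have lq : 1 - f <= l `^ (p - 1) * q `^ (p - 1).
  rewrite -powRM ?(ltW l0)//; apply: dr; first by nra.
  by rewrite mulr_ile1 ?(ltW l0).
have t2 : 2 * (p - 1) * (1 - l) / S <= f.
  rewrite ler_pdivrMr//; apply: le_trans (_ : f * c <= _); last first.
    by rewrite ler_wpM2l ?(ltW f0).
  apply: le_trans (_ : 2 * (p - 1) * (eta ^+ 2 / (4 * c ^+ 2)) <= _).
    by rewrite ler_wpM2l ?mulr_ge0 ?(ltW p1).
  have ee : eta ^+ 2 <= c * (f / (p - 1) * c ^+ 2).
    rewrite expr2 ler_pM ?(ltW h0)//; apply: (le_trans hc).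
    by rewrite ler_piMr ?(ltW c0).
  apply: le_trans (_ : 2 * (p - 1) * (c * (f / (p - 1) * c ^+ 2) / (4 * c ^+ 2)) <= _).
    rewrite ler_wpM2l ?mulr_ge0 ?(ltW p1)// ler_wpM2r// invr_ge0.
    by rewrite mulr_ge0// sqr_ge0.
  have -> : 2 * (p - 1) * (c * (f / (p - 1) * c ^+ 2) / (4 * c ^+ 2)) = f * c / 2.
    by field; rewrite !gt_eqF.
  by have := mulr_gt0 f0 c0; lra.
apply: le_trans (_ : G * (f + f) <= _).
  by rewrite ler_wpM2l ?(ltW G0)//; apply: lerD => //; lra.
apply: le_trans (_ : M `^ g * (f + f) <= _).
  rewrite ler_wpM2r ?addr_ge0 ?(ltW f0)//.
  by rewrite ge0_ler_powR ?nnegrE ?(ltW g0) ?(ltW L0) ?(ltW M0).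
rewrite le_eqVlt; apply/orP; left; apply/eqP; rewrite /f.
by field; rewrite gt_eqF.
Qed.

Let p1 : 0 < p - 1. Proof. by have := p2; lra. Qed.
Let m0 : 0 < p - 2. Proof. by rewrite subr_gt0. Qed.
Let g0 : 0 < g. Proof. by rewrite divr_gt0. Qed.

Let mass_le1 (l q : R) : 0 <= l -> l <= 1 -> 0 <= q -> q <= 1 ->
  0 <= l `^ (p - 1) * (q `^ (p - 2) * q ^+ 2) <= 1.
Proof.
move=> l0 l1 q0 q1; have a0 := powR_ge0 l (p - 1); have b0 := powR_ge0 q (p - 2).
have a1 := powR_le1 l0 l1 (ltW p1); have b1 := powR_le1 q0 q1 (ltW m0).
have c0 := sqr_ge0 q; have c1 : q ^+ 2 <= 1 by rewrite expr_le1.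
have Q1 : q `^ (p - 2) * q ^+ 2 <= 1 by rewrite mulr_ile1.
have Q0 : 0 <= q `^ (p - 2) * q ^+ 2 by rewrite mulr_ge0.
by rewrite mulr_ge0//= mulr_ile1.
Qed.

(** The terms dropped are nonnegative: they come from the front, which moves at
    least as fast as diffusion pushes it, and from the curvature. *)
Lemma supersolution_defect (S l q E : R) : 0 < S -> 0 <= l -> l <= 1 ->
  0 <= q -> q <= 1 -> 0 <= E ->
  - (1 - l `^ (p - 1) * q `^ (p - 1) + 2 * (p - 1) * (1 - l) / S) <=
  1 * g / S - 1 - l `^ (p - 1) * ((g + 2 * (p - 1) * (1 - l)) *
     (q `^ (p - 2) * q ^+ 2) / S - E - q `^ (p - 1)).
Proof.
move=> S0 l0 l1 q0 q1 E0; have /andP[a0 a1] := mass_le1 l0 l1 q0 q1.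
have la0 := powR_ge0 l (p - 1).
rewrite -subr_ge0; set a := l `^ (p - 1) in a0 a1 la0 *.
set Q := q `^ _ * _ in a0 a1 *; set b := q `^ (p - 1).
have -> : 1 * g / S - 1 - a * ((g + 2 * (p - 1) * (1 - l)) * Q / S - E - b)
   - - (1 - a * b + 2 * (p - 1) * (1 - l) / S) =
   (g + 2 * (p - 1) * (1 - l)) * (1 - a * Q) / S + a * E.
  by field; rewrite gt_eqF//= gt_eqF.
apply: addr_ge0; last exact: mulr_ge0.
apply: divr_ge0; last exact: ltW.
apply: mulr_ge0; last by rewrite subr_ge0.
apply: addr_ge0; first exact: ltW.
by rewrite !mulr_ge0 ?(ltW p1) ?subr_ge0.
Qed.

(** The slack [sig] between the decay rate [Lam] and absorption plus curvature
    remains available to pay for a front that moves too fast where q < 1. *)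
Lemma subsolution_defect (Lam th sig S l q E : R) : 0 < S -> 0 <= l -> l <= 1 ->
  0 <= q -> q <= 1 -> sig <= Lam -> E + q `^ (p - 1) <= Lam - sig ->
  th * g / S - Lam - l `^ (p - 1) * ((g + 2 * (p - 1) * (1 - l)) *
     (q `^ (p - 2) * q ^+ 2) / S - E - q `^ (p - 1)) <=
  - sig + g / S * (th - l `^ (p - 1) * (q `^ (p - 2) * q ^+ 2)).
Proof.
move=> S0 l0 l1 q0 q1 sL EL; have /andP[a0 _] := mass_le1 l0 l1 q0 q1.
have la0 := powR_ge0 l (p - 1); have la1 := powR_le1 l0 l1 (ltW p1).
rewrite -subr_ge0; set a := l `^ (p - 1) in a0 la0 la1 *.
set Q := q `^ _ * _ in a0 *; set b := q `^ (p - 1) in EL *.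
have -> : - sig + g / S * (th - a * Q) - (th * g / S - Lam -
   a * ((g + 2 * (p - 1) * (1 - l)) * Q / S - E - b)) =
   (2 * (p - 1) * (1 - l)) * (a * Q) / S + a * (Lam - sig - (E + b))
   + (1 - a) * (Lam - sig).
  by field; rewrite gt_eqF//= gt_eqF.
apply: addr_ge0; last by rewrite mulr_ge0 ?subr_ge0.
apply: addr_ge0; last by rewrite mulr_ge0 ?subr_ge0.
apply: divr_ge0; last exact: ltW.
apply: mulr_ge0 => //; by rewrite !mulr_ge0 ?(ltW p1) ?subr_ge0.
Qed.

End absorption_estimates.

(** * Uniform estimates for powers and coefficients *)

Section more_estimates.
Context {R : realType}.

(** Near z = 0 both sides are small; away from 0 write z + h = z (1 + h/z) and
    use continuity of the power at 1, so that exponents below and above 1 are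
    treated together. *)
Lemma powR_unif_right (s C e : R) : 0 < s -> 0 < C -> 0 < e ->
  exists2 d, 0 < d & forall z h, 0 <= z <= C -> 0 <= h <= d ->
    (z + h) `^ s <= z `^ s + e.
Proof.
move=> s0 C0 e0.
have [c /andP[c0 c1] ce] := powR_small s0 e0.
have Cs : 0 < C `^ s by rewrite powR_gt0.
have f0 : 0 < e / C `^ s by rewrite divr_gt0.
have Cn := is_derive_continuous (is_derive1_powR s (@ltr01 R)).
have /cvgrPdist_lt /(_ _ f0) [d /= d0 H] := Cn.
exists (Num.min (c / 2) (c / 2 * (d / 2))).
  by rewrite lt_min; apply/andP; split; [exact: divr_gt0|rewrite mulr_gt0// divr_gt0].
move=> z h /andP[z0 zC] /andP[h0]; rewrite le_min => /andP[h1 h2].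
have [zc|zc] := leP z (c / 2).
  apply: le_trans (_ : e <= _); last by rewrite lerDr powR_ge0.
  apply: le_trans ce; apply: ge0_ler_powR; rewrite ?nnegrE ?(ltW s0) ?(ltW c0) ?addr_ge0//.
  lra.
have c20 : 0 < c / 2 by rewrite divr_gt0.
have zp : 0 < z by apply: lt_trans zc.
have -> : z + h = z * (1 + h / z) by field; rewrite gt_eqF.
have hz : h / z <= d / 2.
  rewrite ler_pdivrMr// mulrC; apply: (le_trans h2).
  by rewrite ler_wpM2r ?divr_ge0 ?(ltW d0) ?(ltW zc).
have hz0 : 0 <= h / z by rewrite divr_ge0.
rewrite powRM ?addr_ge0//.
have P : (1 + h / z) `^ s <= 1 + e / C `^ s.
  have B : `|1 - (1 + h / z)| < d.
    by rewrite opprD addrA subrr sub0r normrN ger0_norm//; lra.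
  have /ltW := H _ B; rewrite powR1 ler_norml => /andP[+ _].
  by rewrite lerBrDr; lra.
apply: le_trans (_ : z `^ s * (1 + e / C `^ s) <= _).
  by rewrite ler_wpM2l ?powR_ge0.
rewrite mulrDr mulr1 lerD2l.
apply: le_trans (_ : C `^ s * (e / C `^ s) <= _).
  rewrite ler_wpM2r ?(ltW f0)// ge0_ler_powR ?nnegrE ?(ltW s0) ?(ltW C0)//.
by rewrite mulrC divfK// gt_eqF.
Qed.

Lemma height_le (p Lam tau s t : R) : 2 < p -> 0 < Lam -> 0 < tau ->
  0 <= s -> s <= t -> height p Lam tau t <= height p Lam tau s.
Proof.
move=> p2 L0 tau0 s0 st; have m0 : 0 < p - 2 by rewrite subr_gt0.
have t0 := le_trans s0 st.
have c0 : 0 < (p - 2) * Lam * ((p - 1) / (p - 2)) `^ (p - 1).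
  by rewrite !mulr_gt0// powR_gt0// divr_gt0//; lra.
have P r : 0 <= r -> 0 < (p - 2) * Lam * ((p - 1) / (p - 2)) `^ (p - 1) * (r + tau).
  by move=> r0; rewrite mulr_gt0//; lra.
rewrite /height !powRN lef_pV2 ?posrE ?powR_gt0 ?P//.
rewrite ge0_ler_powR ?nnegrE ?invr_ge0 ?(ltW m0) ?(ltW (P _ _))//.
by rewrite ler_wpM2l ?(ltW c0)// lerD2r.
Qed.

Lemma ramp_large (d T B : R) : 0 < d -> 0 < T ->
  exists2 lam, 0 < lam & B <= ramp d lam T (2 * T).
Proof.
move=> d0 T0; exists ((`|B| / d + 1) / T).
  by rewrite divr_gt0// ltr_wpDl ?divr_ge0 ?(ltW d0).
rewrite /ramp; have -> : (`|B| / d + 1) / T * (2 * T - T) = `|B| / d + 1.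
  by field; rewrite !gt_eqF.
apply: le_trans (ler_norm _) _.
apply: le_trans (_ : d * (`|B| / d + 1) <= _).
  by rewrite mulrDr mulr1 mulrC divfK ?gt_eqF// lerDl ltW.
rewrite ler_wpM2l ?(ltW d0)//; apply: le_trans (expR_ge1Dx _).
by rewrite lerDr.
Qed.

Lemma ramp_homo (d lam T s t : R) : 0 <= d -> 0 <= lam -> s <= t ->
  ramp d lam T s <= ramp d lam T t.
Proof.
by move=> d0 l0 st; rewrite ler_wpM2l// ler_expR ler_wpM2l// lerD2r.
Qed.

Lemma rampT (d lam T : R) : ramp d lam T T = d.
Proof. by rewrite /ramp subrr mulr0 expR0 mulr1. Qed.

Lemma ramp_gt0 (d lam T t : R) : 0 < d -> 0 < ramp d lam T t.
Proof. by move=> d0; rewrite mulr_gt0// expR_gt0. Qed.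

End more_estimates.

(** * The upper bound *)

(** Far from its centre the smoothed distance is nearly a distance. *)
Lemma slope_near1 {R : realType} (N : nat) (K q0 : R) : 0 < K -> q0 < 1 ->
  exists2 r : R, 0 < r &
  forall y x : 'rV[R]_N, r <= sdist K y x -> q0 <= slope K y x.
Proof.
move=> K0 q01; have d0 : 0 < 1 - q0 by rewrite subr_gt0.
exists (K * (1 + (1 - q0)^-1)); first by rewrite mulr_gt0// addr_gt0// invr_gt0.
move=> y x rx; have P0 := sdist_gt0 y K0 x.
have s0 := slope_ge0 y K0 x; have s1 := slope_le1 y K0 x.
apply: le_trans (_ : slope K y x ^+ 2 <= _); last by rewrite expr2 ler_piMr.
rewrite (slope_sqr y K0 x) lerBrDr -lerBrDl.
have i0 : 0 <= K / sdist K y x by rewrite divr_ge0 ?ltW.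
have i1 : K / sdist K y x <= 1 by rewrite ler_pdivrMr// mul1r sdist_geK.
apply: le_trans (_ : K / sdist K y x <= _); first by rewrite expr2 ler_piMr.
rewrite ler_pdivrMr// mulrC -ler_pdivrMr//; apply: le_trans rx.
by rewrite ler_wpM2l ?(ltW K0)// lerDr.
Qed.

Section upper_bound.
Context {R : realType} {N : nat}.
Variables (p R0 M : R) (u : R -> 'rV[R]_N -> R).
Hypotheses (N1 : (1 <= N)%N) (p2 : 2 < p) (R00 : 0 < R0) (M0 : 0 < M).
Hypothesis u_cont : {within [set z : R * 'rV[R]_N | 0 <= z.1],
    continuous (fun z => u z.1 z.2)}.
Hypothesis u_le : forall t x, 0 <= t -> u t x <= M.
Hypothesis u_sub : viscosity_subsolution p u.
Hypothesis u_supp : forall x, R0 <= enorm x -> u 0 x <= 0.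
Local Notation g := ((p - 1) / (p - 2)).

Let m0 : 0 < p - 2. Proof. by rewrite subr_gt0. Qed.
Let p1 : 0 < p - 1. Proof. by have := p2; lra. Qed.
Let g0 : 0 < g. Proof. by rewrite divr_gt0. Qed.

Section cone.
Variables (eps d lam T : R) (y : 'rV[R]_N).
Hypothesis (eps0 : 0 < eps).

Definition cone : R -> 'rV[R]_N -> R :=
  barrier (cst 1) (cst 0) (ramp d lam T) (fun z => - eps * z) 1 y.

Lemma coneE t x : cone t x = eps * sdist 1 y x + ramp d lam T t.
Proof. by rewrite /cone /barrier /=; ring. Qed.

Let C1_cst (c : R) : C1_nneg (cst c) (cst 0).
Proof. by split=> t _; [exact: (is_derive_const c t 1)|exact: cst_continuous]. Qed.

Let C2_lin : C2_profile (p - 2) (fun z => - eps * z) (cst (- eps)) (cst 0) (cst 0).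
Proof.
split=> [z|z||z]; last exact: (is_derive_const (`|- eps| `^ (p - 2) * - eps) z 1).
- by apply: (is_derive_eq (is_derive_scale (- eps) (is_derive_id z 1))); rewrite mulr1.
- exact: (is_derive_const (- eps) z 1).
- exact: cst_continuous.
Qed.

Lemma C12_cone : C12_pos cone.
Proof. exact: (C12_barrier y ltr01 (C1_cst 1) (C1_cst 0) (C1_ramp d lam T) C2_lin). Qed.

Lemma continuous_cone (t : R) x : 0 <= t ->
  {for (t, x), continuous (fun z : R * 'rV[R]_N => cone z.1 z.2)}.
Proof.
move=> t0; rewrite /cone.
exact: (continuous_barrier (C1_cst 1) (C1_cst 0) (C1_ramp d lam T) C2_lin).
Qed.

Lemma pde_lhs_cone (t : R) x : 0 <= t -> eps <= 1 ->
  lam * ramp d lam T t - eps * (N%:R + (p - 2)) <= pde_lhs p cone t x.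
Proof.
move=> t0 e1.
rewrite (pde_lhs_barrier y p2 ltr01 (C1_cst 1) (C1_cst 0) (C1_ramp d lam T) C2_lin)//=.
rewrite powR1 normrN (gtr0_norm eps0).
have E0 := flux_div_ge0 y p2 ltr01 x N1.
have E1 := flux_div_le y p2 ltr01 x; rewrite divr1 in E1.
have e2 : eps `^ (p - 2) <= 1 by rewrite powR_le1 ?(ltW eps0)// ltW.
have e3 := powR_ge0 eps (p - 2).
have q0 := powR_ge0 (1 * eps * slope 1 y x) (p - 1).
set E := flux_div _ _ _ _ in E0 E1 *; set Q := _ `^ (p - 1) in q0 *.
set e := _ `^ (p - 2) in e2 e3 *.
have : e * eps * E <= eps * (N%:R + (p - 2)).
  apply: ler_pM => //; first by rewrite mulr_ge0 ?(ltW eps0).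
  by rewrite ler_piMl ?(ltW eps0).
lra.
Qed.

End cone.

(** The cone eps * phi centred at a far point Y dominates u at time 0, once
    |Y| >= R0 + M / eps, and at infinity because it grows.  It fails to be a
    supersolution by a term of order eps, which the ramp pays for, and at Y
    itself it is of size eps, up to the ramp. *)
Lemma decay_at_infinity (T d : R) : 0 < T -> 0 < d ->
  exists rho, forall t x, 0 <= t <= T -> rho <= `|x| -> u t x <= d.
Proof.
move=> T0 d0; have d20 : 0 < d / 2 by rewrite divr_gt0.
have [lam l0 lB] := ramp_large M d20 T0.
pose kap := lam * ramp (d / 2) lam T 0.
have kap0 : 0 < kap by rewrite mulr_gt0// ramp_gt0.
have Nm : 0 < N%:R + (p - 2) by rewrite ltr_wpDl.
pose eps := Num.min (Num.min 1 (d / 2)) (kap / (2 * (N%:R + (p - 2)))).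
have eps0 : 0 < eps by rewrite !lt_min ltr01 d20 divr_gt0// mulr_gt0.
have eps1 : eps <= 1 by rewrite !ge_min lexx.
have epsd : eps <= d / 2 by rewrite !ge_min lexx orbT.
have epsk : eps <= kap / (2 * (N%:R + (p - 2))) by rewrite !ge_min lexx !orbT.
exists (R0 + M / eps) => t Y /andP[t0 tT] Yr.
have phiY x : `|x - Y| <= sdist 1 Y x.
  by apply: le_trans (sdist_ge_enorm Y ltr01 x); exact: norm_le_enorm.
have rp s : 0 <= s -> ramp (d / 2) lam T 0 <= ramp (d / 2) lam T s.
  by move=> s0; rewrite ramp_homo ?(ltW d20) ?(ltW l0).
have rp0 := ramp_gt0 lam T 0 d20.
have big x : M / eps <= sdist 1 Y x -> M <= eps * sdist 1 Y x.
  by rewrite ler_pdivrMr// mulrC.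
have : u t Y <= cone eps (d / 2) lam T Y t Y.
  pose f := cone eps (d / 2) lam T Y.
  have cf s x : 0 <= s -> {for (s, x), continuous (fun z : R * 'rV[R]_N => f z.1 z.2)}.
    by move=> s0; apply: continuous_cone.
  have Cf : C12_pos f by apply: C12_cone.
  apply: (comparison_above u_cont cf Cf (lexx 0) (t2 := 2 * T)
     (rho := M / eps + `|Y|) u_sub) => //; rewrite ?/f.
  - move=> x; rewrite coneE; have [xR|xR] := leP R0 (enorm x).
      apply: (le_trans (u_supp xR)).
      by rewrite addr_ge0 ?(ltW rp0)// mulr_ge0 ?(ltW eps0)// ltW// sdist_gt0.
    rewrite (le_trans (u_le x (lexx 0)))//.
    apply: le_trans (_ : eps * sdist 1 Y x <= _); last by rewrite lerDl ltW.
    apply: big; apply: le_trans (phiY x).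
    have := lerB_dist x Y; have := ler_distD x Y 0.
    rewrite !subr0 (distrC Y x) => h _.
    by have := norm_le_enorm x; lra.
  - move=> x; rewrite coneE (le_trans (u_le x _)) ?mulr_ge0 ?(ltW T0)//.
    rewrite (le_trans lB)// lerDr.
    by rewrite mulr_ge0 ?(ltW eps0)// ltW// sdist_gt0.
  - move=> s x /andP[s0 _] xr; rewrite coneE (le_trans (u_le x s0))//.
    apply: le_trans (_ : eps * sdist 1 Y x <= _); last first.
      by rewrite lerDl (le_trans (ltW rp0))// rp.
    apply: big; apply: le_trans (phiY x).
    by have := lerB_dist x Y; have := ler_norm (`|x| - `|Y|); lra.
  - move=> s x /andP[s0 _] _.
    apply: lt_le_trans (pde_lhs_cone _ _ _ _ _ _ (ltW s0) _) => //.
    apply: lt_le_trans (_ : kap / 2 <= _); first by rewrite divr_gt0.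
    have : kap <= lam * ramp (d / 2) lam T s by rewrite ler_wpM2l ?(ltW l0)// rp// ltW.
    have : eps * (N%:R + (p - 2)) <= kap / 2.
      rewrite -ler_pdivlMr//; apply: (le_trans epsk).
      by rewrite invfM mulrA.
    lra.
  - by rewrite t0; lra.
move=> h; apply: (le_trans h); rewrite coneE.
have : sdist 1 Y Y <= 1.
  have := sdist_le Y ltr01 Y; suff -> : enorm (Y - Y) = 0 by rewrite addr0.
  by rewrite subrr /enorm big1 ?sqrtr0// => i _; rewrite mxE expr0n.
have : ramp (d / 2) lam T t <= d / 2.
  by rewrite -[leRHS](rampT (d / 2) lam T) ramp_homo ?(ltW d20) ?(ltW l0).
have := sdist_gt0 Y ltr01 Y; nra.
Qed.

(** For a centre y opposite to x, |x - y| - |y| is exactly |x|, so nothing is lost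
    at x by replacing the planar barrier with a radial one. *)
Lemma opposite_center x (r : R) : 0 <= r ->
  exists y : 'rV[R]_N, enorm y = r /\ enorm (x - y) = enorm x + r.
Proof.
move=> r0; have [x0|x0] := eqVneq (enorm x) 0.
  pose i0 : 'I_N := Ordinal N1.
  have d1 : enorm (delta_mx 0 i0 : 'rV[R]_N) = 1.
    rewrite /enorm (bigD1 i0)//= big1 => [|j ij]; rewrite !mxE ?eqxx/=.
      by rewrite addr0 expr1n sqrtr1.
    by rewrite (negbTE ij) expr0n.
  exists (r *: delta_mx 0 i0); rewrite enormZ d1 ger0_norm// mulr1; split=> //.
  by rewrite x0 (enorm_eq0 x0) sub0r -scaleNr enormZ d1 normrN ger0_norm// mulr1 add0r.
have xp : 0 < enorm x by rewrite lt_def x0 enorm_ge0.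
exists (- (r / enorm x) *: x); rewrite enormZ normrN ger0_norm ?divr_ge0 ?(ltW xp)//.
split; first by rewrite divfK.
have -> : x - - (r / enorm x) *: x = (1 + r / enorm x) *: x.
  by rewrite scalerDl scale1r scaleNr opprK.
rewrite enormZ ger0_norm ?addr_ge0 ?divr_ge0 ?(ltW xp)//.
by rewrite mulrDl mul1r divfK.
Qed.

Lemma front_ge (Lam th alpha t : R) : 0 < Lam -> 0 <= th -> 0 <= t ->
  alpha <= front p Lam th 1 alpha t.
Proof.
move=> L0 th0 t0; rewrite lerDl mulr_ge0 ?divr_ge0 ?mulr_ge0 ?(ltW L0) ?(ltW m0)//.
by rewrite ln_ge0// lerDr.
Qed.

Lemma front0 (Lam th alpha : R) : front p Lam th 1 alpha 0 = alpha.
Proof. by rewrite /front add0r ln1 mulr0 addr0. Qed.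

(** The barrier is the exact planar solution, bent around a centre at distance
    [rad] from the origin opposite to the point of interest.  The bending does
    no harm: where the barrier lies below u, hence below M, the argument of the
    profile is bounded, so the point is far from the centre and the slope is
    close to 1.  The error is beaten by the derivative of the ramp. *)
Lemma upper_bound : exists A, forall t x, 0 <= t ->
  u t x <= height p 1 1 t *
    Num.max (front p 1 1 1 A t - enorm x) 0 `^ g.
Proof.
have h00 : 0 < height p 1 1 0 := height_gt0 p2 ltr01 ltr01 (lexx 0).
(* the initial barrier reaches the height M at distance c behind its front *)
pose c := (M / height p 1 1 0) `^ g^-1.
have cg : height p 1 1 0 * c `^ g = M.
  rewrite -powRrM mulVf ?gt_eqF// powRr1 ?divr_ge0 ?(ltW M0) ?(ltW h00)//.
  by rewrite mulrC divfK// gt_eqF.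
have c0 : 0 <= c by rewrite powR_ge0.
pose A := 1 + R0 + c.
have A0 : 0 <= A by have := R00; rewrite /A; lra.
exists A => ts xs ts0; apply/ler_addgt0Pr => e e0.
pose T := Num.max ts 1.
have T0 : 0 < T by rewrite lt_max ltr01 orbT.
have tsT : ts <= T by rewrite le_max lexx.
pose d := e / 2; have d0 : 0 < d by rewrite divr_gt0.
have [lam l0 lB] := ramp_large M d0 T0.
pose kap := lam * ramp d lam T 0.
have rp0 := ramp_gt0 lam T 0 d0.
have kap0 : 0 < kap by rewrite mulr_gt0.
have rp s : 0 <= s -> ramp d lam T 0 <= ramp d lam T s.
  by move=> s0; rewrite ramp_homo ?(ltW d0) ?(ltW l0).
have T20 : 0 <= 2 * T by rewrite mulr_ge0// ltW.
have h20 : 0 < height p 1 1 (2 * T) := height_gt0 p2 ltr01 ltr01 T20.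
(* the argument of the profile is at most Lm wherever the barrier is below M *)
pose Lm := (M / height p 1 1 (2 * T)) `^ g^-1.
have Lm0 : 0 < Lm by rewrite powR_gt0// divr_gt0.
pose Bm := height p 1 1 0 / (p - 2).
have Bm0 : 0 < Bm by rewrite divr_gt0.
have k2 : 0 < kap / (2 * Bm) by rewrite divr_gt0// mulr_gt0.
have [eta1 eta10 [q0 q01 Herr]] := regularization_error p2 Lm0 k2.
have [r r0 slope_q0] := slope_near1 N ltr01 q01.
pose Z := Num.max (front p 1 1 1 A ts - enorm xs) 0.
have Z0 : 0 <= Z by rewrite le_max lexx orbT.
have hts0 : 0 < height p 1 1 ts := height_gt0 p2 ltr01 ltr01 ts0.
have e2 : 0 < e / 2 / height p 1 1 ts by rewrite !divr_gt0.
have [eta2 eta20 Hunif] := powR_unif_right g0 (ltr_wpDl Z0 ltr01) e2.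
pose eta := Num.min eta1 eta2.
have eta0 : 0 < eta by rewrite lt_min eta10.
pose rad := Lm + r.
have rad0 : 0 <= rad by rewrite addr_ge0 ?ltW.
have [y [yE xyE]] := opposite_center xs rad0.
pose f := @power_barrier R N p 1 1 1 (A + rad) d lam T eta 1 y.
have fE t x : f t x = height p 1 1 t *
   pospart eta (front p 1 1 1 (A + rad) t - sdist 1 y x) `^ g + ramp d lam T t by [].
have h0 t : 0 <= t -> 0 < height p 1 1 t by move=> t0; exact: height_gt0.
have f_ramp t x : 0 <= t -> ramp d lam T t <= f t x.
  by move=> t0; rewrite fE lerDr mulr_ge0 ?powR_ge0// ltW// h0.
have frontE t : front p 1 1 1 (A + rad) t = front p 1 1 1 A t + rad.
  by rewrite /front; ring.
have cf s x : 0 <= s -> {for (s, x), continuous (fun z : R * 'rV[R]_N => f z.1 z.2)}.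
  by move=> s0; apply: continuous_power_barrier.
have Cf : C12_pos f by apply: C12_power_barrier.
have [rho Hrho] := decay_at_infinity (mulr_gt0 (@ltr0Sn R 1) T0) rp0.
have : u ts xs <= f ts xs.
  apply: (comparison_above u_cont cf Cf (lexx 0) (t2 := 2 * T) (rho := rho) u_sub).
  - move=> x; have [xR|xR] := leP R0 (enorm x).
      apply: (le_trans (u_supp xR)); apply: le_trans (f_ramp 0 x (lexx 0)).
      exact: ltW.
    rewrite fE (le_trans (u_le x (lexx 0)))// -cg.
    apply: le_trans (_ : height p 1 1 0 * pospart eta
       (front p 1 1 1 (A + rad) 0 - sdist 1 y x) `^ g <= _); last by rewrite lerDl ltW.
    rewrite ler_wpM2l ?(ltW h00)//.
    have cL : c <= pospart eta (front p 1 1 1 (A + rad) 0 - sdist 1 y x).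
      apply: le_trans (pospart_ge eta0 _); rewrite front0.
      have := sdist_le y ltr01 x; have := enormD x (- y).
      have -> : enorm (- y) = rad by rewrite -scaleN1r enormZ normrN normr1 mul1r.
      by move: xR; rewrite /A; lra.
    exact: powR_homo (ltW g0) c0 cL.
  - move=> x; apply: (le_trans (u_le x T20)); apply: (le_trans lB).
    exact: f_ramp.
  - move=> t x tt xr; apply: (le_trans (Hrho t x tt xr)).
    case/andP: tt => t0 _; apply: le_trans (f_ramp t x t0); exact: rp.
  - move=> t x /andP[/ltW t0 tT] fu.
    set z := front p 1 1 1 (A + rad) t - sdist 1 y x in fE.
    have ht0 := h0 t t0.
    have zM : pospart eta z <= Lm.
      have L0 := pospart_gt0 eta0 z.
      have : height p 1 1 (2 * T) * pospart eta z `^ g <= M.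
        apply: le_trans (_ : height p 1 1 t * pospart eta z `^ g <= _).
          by rewrite ler_wpM2r ?powR_ge0// height_le// ltW.
        apply: le_trans (u_le x t0); apply: le_trans (ltW fu).
        rewrite fE lerDl (le_trans (ltW rp0))//; exact: rp.
      rewrite mulrC -(ler_pdivlMr _ _ h20) => H.
      have -> : pospart eta z = (pospart eta z `^ g) `^ g^-1.
        by rewrite -powRrM mulfV ?gt_eqF// powRr1// ltW.
      have ig0 : 0 <= g^-1 by rewrite invr_ge0 ltW.
      exact: powR_homo ig0 (powR_ge0 _ _) H.
    have qq : q0 <= slope 1 y x.
      apply: slope_q0.
      have := pospart_ge eta0 z; have := front_ge A ltr01 ler01 t0.
      by move: A0 zM; rewrite /z frontE /rad; lra.
    have eta01 : 0 < eta <= eta1 by rewrite eta0 ge_min lexx.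
    have := Herr eta z (slope 1 y x) eta01 qq (slope_le1 y ltr01 x) zM.
    rewrite /f (pde_lhs_power_barrier 1 (A + rad) d lam T y p2 ltr01 ltr01 eta0 ltr01 x t0).
    rewrite -/z.
    have S0 := hypot_gt0 eta0 z; have L0 := pospart_gt0 eta0 z.
    set l := pospart eta z / hypot eta z; set G := pospart eta z `^ g.
    have lp0 : 0 <= l by rewrite divr_ge0 ?(ltW S0) ?(ltW L0).
    have l1 : l <= 1 by rewrite ler_pdivrMr// mul1r pospart_le_hypot.
    have q0' := slope_ge0 y ltr01 x; have q1' := slope_le1 y ltr01 x.
    have E0 := flux_div_ge0 y p2 ltr01 x N1.
    have BrX := supersolution_defect p2 S0 lp0 l1 q0' q1' E0.
    set X := (X in G * X <= _) => HX.
    set Br := (X in _ <= X) in BrX; rewrite -/X in BrX; rewrite -/Br.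
    set B := height p 1 1 t / _.
    have s1 : 1 <= t + 1 by rewrite lerDr.
    have ms : p - 2 <= (p - 2) * 1 * (t + 1) by rewrite mulr1 ler_peMr// ltW.
    have ms0 : 0 < (p - 2) * 1 * (t + 1) := lt_le_trans m0 ms.
    have B0 : 0 < B by rewrite divr_gt0.
    have BB : B <= Bm.
      apply: ler_pM; [exact: ltW|by rewrite invr_ge0 ltW|exact: height_le|].
      by rewrite lef_pV2 ?posrE.
    have G0 : 0 <= G := powR_ge0 _ _.
    have H1 : B * (G * X) <= kap / 2.
      apply: le_trans (_ : B * (kap / (2 * Bm)) <= _).
        by rewrite ler_wpM2l ?(ltW B0).
      apply: le_trans (_ : Bm * (kap / (2 * Bm)) <= _).
        by rewrite ler_wpM2r ?(ltW k2).
      by rewrite le_eqVlt; apply/orP; left; apply/eqP; field; rewrite gt_eqF.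
    have H2 : - (B * (G * X)) <= B * G * Br.
      rewrite -mulrA -mulrN -mulrN; apply: ler_wpM2l; first exact: ltW.
      exact: ler_wpM2l.
    have H3 : kap <= lam * ramp d lam T t by rewrite ler_wpM2l ?(ltW l0)// rp.
    move: kap0 H1 H2 H3; lra.
  - by rewrite ts0; have := T0; lra.
move=> h; apply: (le_trans h); rewrite fE frontE.
have r1 : ramp d lam T ts <= e / 2.
  by rewrite -[leRHS](rampT d lam T) ramp_homo ?(ltW d0) ?(ltW l0).
set z := _ + rad - _.
have zZ : z <= Z.
  rewrite le_max; apply/orP; left; rewrite /z.
  by have := sdist_ge_enorm y ltr01 xs; rewrite xyE; lra.
have LZ : pospart eta z <= Z + eta.
  apply: le_trans (pospart_le eta0 z) _; rewrite lerD2r ge_max zZ.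
  exact: Z0.
have : pospart eta z `^ g <= Z `^ g + e / 2 / height p 1 1 ts.
  apply: le_trans (_ : (Z + eta) `^ g <= _).
    exact: powR_homo (ltW g0) (ltW (pospart_gt0 eta0 z)) LZ.
  apply: Hunif; first by rewrite Z0 lerDl ler01.
  by rewrite (ltW eta0) ge_min lexx orbT.
rewrite -(ler_pM2l hts0) => H.
have E : height p 1 1 ts * (e / 2 / height p 1 1 ts) = e / 2.
  by field; rewrite gt_eqF.
rewrite mulrDr E in H.
by lra.
Qed.

End upper_bound.

(** * Subsolutions and the lower bound *)

Section lower_bound.
Context {R : realType} {N : nat}.
Variables (p : R) (u : R -> 'rV[R]_N -> R).
Hypothesis p2 : 2 < p.
Hypothesis u_cont : {within [set z : R * 'rV[R]_N | 0 <= z.1],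
    continuous (fun z => u z.1 z.2)}.
Hypothesis u_ge0 : forall t x, 0 <= t -> 0 <= u t x.
Hypothesis u_super : viscosity_supersolution p u.
Local Notation g := ((p - 1) / (p - 2)).

Let m0 : 0 < p - 2. Proof. by rewrite subr_gt0. Qed.
Let p1 : 0 < p - 1. Proof. by have := p2; lra. Qed.
Let g0 : 0 < g. Proof. by rewrite divr_gt0. Qed.

Lemma front_homo (Lam th tau alpha s t : R) : 0 < Lam -> 0 <= th -> 0 < tau ->
  0 <= s -> s <= t -> front p Lam th tau alpha s <= front p Lam th tau alpha t.
Proof.
move=> L0 th0 tau0 s0 st; rewrite /front lerD2l.
apply: ler_wpM2l; first by rewrite divr_ge0// mulr_ge0 ?(ltW L0) ?(ltW m0).
have st0 : 0 < s + tau by rewrite ltr_wpDl.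
have tt0 : 0 < t + tau by rewrite ltr_wpDl// (le_trans s0).
by rewrite ler_ln ?posrE// lerD2r.
Qed.

(** Let l' = l^(p-1) and Q = q^p.  By [subsolution_defect] the barrier is a
    subsolution if - sig + g/S (th - l' Q) <= 0.  Where Q >= th1 this follows
    from l' >= th / th1, which holds for small eta because the barrier, being
    above u >= 0, has L bounded below there.  Where Q < th1 the first hypothesis
    places the point at distance at least g th / sig behind the front, so
    g th / S <= sig.  The initial condition only asks that u be at least [d1] on
    the initial support, [d1] being an upper bound of the barrier. *)
Lemma subsolution_bound (K sig Lam th th1 tau alpha a0 t1 d1 : R) (y : 'rV[R]_N) :
  0 < K -> 0 < sig -> Lam = 1 + (N%:R + (p - 2)) / K + sig ->
  0 < th -> th < th1 -> 0 < tau -> 0 <= a0 -> 0 <= t1 ->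
  (forall x, slope K y x `^ (p - 2) * slope K y x ^+ 2 < th1 ->
     sdist K y x + g * th / sig <= a0) ->
  front p Lam th tau alpha t1 = a0 ->
  height p Lam tau t1 * (a0 + 1) `^ g <= d1 ->
  (forall x, sdist K y x <= a0 -> d1 <= u t1 x) ->
  forall t x, t1 <= t -> height p Lam tau t *
    Num.max (front p Lam th tau alpha t - sdist K y x) 0 `^ g <= u t x.
Proof.
move=> K0 sig0 LamE th0 th01 tau0 a00 t10 Hslope ft1 hd1 hu1 ts xs t1s.
have Nm : 0 < N%:R + (p - 2) by rewrite ltr_wpDl.
have NK : 0 < (N%:R + (p - 2)) / K by rewrite divr_gt0.
have Lam0 : 0 < Lam by rewrite LamE !addr_gt0.
have ts0 := le_trans t10 t1s.
apply/ler_addgt0Pr => e e0.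
pose T := Num.max ts 1.
have T0 : 0 < T by rewrite lt_max ltr01 orbT.
have tsT : ts <= T by rewrite le_max lexx.
have tsT2 : ts <= 2 * T by lra.
have t1T2 : t1 <= 2 * T := le_trans t1s tsT2.
set b := height p Lam tau; set a := front p Lam th tau alpha in ft1 *.
have b0 t : 0 <= t -> 0 < b t by move=> t0; exact: height_gt0.
have b_le s t : 0 <= s -> s <= t -> b t <= b s by move=> s0 st; exact: height_le.
have a_le s t : 0 <= s -> s <= t -> a s <= a t.
  by move=> s0 st; apply: front_homo => //; exact: ltW.
have T20 := le_trans t10 t1T2.
have aT0 : a0 <= a (2 * T) by rewrite -ft1 a_le.
have [lam l0 lB] := ramp_large (b t1 * (a (2 * T) + 1) `^ g) e0 T0.
pose k0 := ramp e lam T 0.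
have k00 : 0 < k0 by rewrite ramp_gt0.
have k0_le t : 0 <= t -> k0 <= ramp e lam T t.
  by move=> t0; rewrite ramp_homo ?(ltW e0) ?(ltW l0).
(* where the barrier is positive, its power part exceeds the ramp, so L >= c *)
pose c := (k0 / b t1) `^ g^-1.
have c0 : 0 < c by rewrite powR_gt0// divr_gt0// b0.
have cg : c `^ g = k0 / b t1.
  by rewrite -powRrM mulVf ?gt_eqF// powRr1// divr_ge0 ?(ltW k00) ?(ltW (b0 _ _)).
have ee : 0 < 1 - th / th1.
  by rewrite subr_gt0 ltr_pdivrMr ?mul1r// (lt_trans th0).
have [d d0 Hd] := powR_near1 (p - 1) ee.
pose eta := Num.min 1 (c * Num.min 1 d).
have m10 : 0 < Num.min 1 d by rewrite lt_min ltr01.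
have eta0 : 0 < eta by rewrite lt_min ltr01 mulr_gt0.
have eta1 : eta <= 1 by rewrite ge_min lexx.
have etac' : eta <= c * Num.min 1 d by rewrite ge_min lexx orbT.
have etac : eta <= c.
  by apply: (le_trans etac'); rewrite ler_piMr ?(ltW c0)// ge_min lexx.
have small z t : t1 <= t -> z <= 0 -> b t * pospart eta z `^ g <= ramp e lam T t.
  move=> t1t z0; have t0 := le_trans t10 t1t.
  apply: le_trans (_ : b t1 * c `^ g <= _); last first.
    by rewrite cg mulrC divfK ?gt_eqF ?b0// k0_le.
  apply: ler_pM; rewrite ?powR_ge0 ?(ltW (b0 _ _))//; first exact: b_le.
  apply: powR_homo; rewrite ?(ltW g0) ?(ltW (pospart_gt0 _ _))//.
  by apply: le_trans (pospart_le eta0 z) _; rewrite max_r// add0r.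
pose f := @power_barrier R N p Lam th tau alpha (- e) lam T eta K y.
have fE t x : f t x = b t * pospart eta (a t - sdist K y x) `^ g - ramp e lam T t.
  by rewrite /f power_barrierE /ramp mulNr.
have cf s x : 0 <= s -> {for (s, x), continuous (fun z : R * 'rV[R]_N => f z.1 z.2)}.
  by move=> s0; apply: continuous_power_barrier.
have Cf : C12_pos f by apply: C12_power_barrier.
have far t x : t1 <= t -> a t - sdist K y x <= 0 -> f t x <= u t x.
  move=> t1t z0; apply: le_trans (u_ge0 x (le_trans t10 t1t)).
  by rewrite fE subr_le0 small.
have : f ts xs <= u ts xs.
  apply: (comparison_below u_cont cf Cf t10 (t2 := 2 * T) (rho := a (2 * T) + `|y|) u_super).
  - move=> x; have [xa|xa] := leP (sdist K y x) a0; last first.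
      by apply: far => //; rewrite ft1 subr_le0 ltW.
    apply: le_trans (hu1 x xa); apply: le_trans hd1; rewrite fE ft1.
    apply: le_trans (_ : b t1 * pospart eta (a0 - sdist K y x) `^ g <= _).
      by rewrite lerBlDr lerDl (le_trans (ltW k00))// k0_le.
    apply: ler_wpM2l; first exact: (ltW (b0 _ t10)).
    apply: powR_homo; rewrite ?(ltW g0) ?(ltW (pospart_gt0 _ _))//.
    apply: le_trans (pospart_le eta0 _) _; rewrite max_l ?subr_ge0//.
    by have := sdist_gt0 y K0 x; lra.
  - move=> x; apply: le_trans (u_ge0 x T20); rewrite fE subr_le0.
    apply: le_trans lB; apply: ler_pM; rewrite ?powR_ge0 ?(ltW (b0 _ _))//.
      exact: b_le.
    apply: powR_homo; rewrite ?(ltW g0) ?(ltW (pospart_gt0 _ _))//.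
    apply: le_trans (pospart_le eta0 _) _; apply: lerD => //.
    rewrite ge_max (le_trans a00 aT0) andbT lerBlDr lerDl.
    exact/ltW/sdist_gt0.
  - move=> t x /andP[t1t tT] xr; apply: far => //; rewrite subr_le0.
    apply: le_trans (a_le _ _ (le_trans t10 t1t) tT) _.
    apply: le_trans (sdist_ge_enorm y K0 x).
    apply: le_trans (norm_le_enorm (x - y)); have := lerB_dist x y.
    by have := ler_norm (`|x| - `|y|); lra.
  - move=> t x /andP[t1t tT] uf.
    have t0 : 0 <= t := le_trans t10 (ltW t1t).
    have uf0 := le_lt_trans (u_ge0 x t0) uf; rewrite fE subr_gt0 in uf0.
    rewrite /f pde_lhs_power_barrier// -/b -/a.
    set z := a t - sdist K y x in uf0 *.
    have S0 := hypot_gt0 eta0 z; have L0 := pospart_gt0 eta0 z.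
    have LS := pospart_le_hypot eta0 z.
    have cL : c <= pospart eta z.
      have H : c `^ g <= pospart eta z `^ g.
        rewrite cg ler_pdivrMr ?b0// mulrC; apply: (le_trans (k0_le t t0)).
        apply: (le_trans (ltW uf0)); apply: ler_wpM2r; first exact: powR_ge0.
        by apply: b_le => //; exact: ltW.
      rewrite leNgt; apply/negP => Lc; move: H; rewrite leNgt.
      by rewrite gt0_ltr_powR ?nnegrE ?(ltW L0) ?(ltW c0).
    have El := pospart_ratio z eta0.
    set l := pospart eta z / hypot eta z in El *.
    have lp0 : 0 <= l by rewrite divr_ge0 ?(ltW S0) ?(ltW L0).
    have l1 : l <= 1 by rewrite (ler_pdivrMr _ _ S0) mul1r.
    have q0' := slope_ge0 y K0 x; have q1' := slope_le1 y K0 x.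
    have ld : 1 - d <= l.
      rewrite lerBlDr addrC -lerBlDr.
      have D0 : 0 < 4 * hypot eta z * pospart eta z.
        by apply: mulr_gt0 => //; apply: mulr_gt0.
      rewrite El (ler_pdivrMr _ _ D0).
      apply: le_trans (_ : (c * Num.min 1 d) ^+ 2 <= _).
        by rewrite ler_sqr ?nnegrE ?(ltW eta0)// mulr_ge0 ?(ltW c0) ?(ltW m10).
      have cL2 : c ^+ 2 <= hypot eta z * pospart eta z.
        by rewrite expr2 ler_pM ?(ltW c0)// (le_trans cL).
      have dd : Num.min 1 d ^+ 2 <= d.
        have md : Num.min 1 d <= d by rewrite ge_min lexx orbT.
        apply: le_trans md; rewrite expr2 ler_piMr ?(ltW m10)//.
        by rewrite ge_min lexx.
      rewrite exprMn; apply: le_trans (_ : c ^+ 2 * d <= _).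
        by rewrite ler_wpM2l ?sqr_ge0.
      rewrite mulrC; apply: ler_wpM2l; first exact: ltW.
      apply: (le_trans cL2); rewrite -mulrA; apply: ler_peMl; last exact: ler1n.
      by rewrite mulr_ge0 ?(ltW S0) ?(ltW L0).
    have la := Hd l ld l1; rewrite opprB addrCA subrr addr0 in la.
    have EL : flux_div p K y x + slope K y x `^ (p - 1) <= Lam - sig.
      rewrite LamE addrK addrC; apply: lerD; last exact: flux_div_le.
      exact: powR_le1 (ltW p1).
    have sL : sig <= Lam by rewrite LamE lerDr ltW// addr_gt0.
    have Br := subsolution_defect p2 th S0 lp0 l1 q0' q1' sL EL.
    set X := (X in X <= _) in Br.
    have X0 : X <= 0.
      apply: (le_trans Br); rewrite addrC subr_le0.
      have [Qth|Qth] := leP th1 (slope K y x `^ (p - 2) * slope K y x ^+ 2).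
        apply: le_trans (ltW sig0); apply: mulr_ge0_le0.
          by rewrite divr_ge0 ?(ltW g0) ?(ltW S0).
        rewrite subr_le0.
        have th10 := lt_trans th0 th01.
        rewrite -[leLHS](@divfK _ th1) ?gt_eqF//.
        by rewrite ler_pM ?divr_ge0 ?(ltW th0) ?(ltW th10).
      have zS : g * th / sig <= hypot eta z.
        apply: le_trans LS; apply: le_trans (pospart_ge eta0 z).
        rewrite lerBrDr addrC; apply: (le_trans (Hslope x Qth)).
        by rewrite -ft1; apply: a_le => //; exact: ltW.
      apply: le_trans (_ : g / hypot eta z * th <= _).
        apply: ler_wpM2l; first by rewrite divr_ge0 ?(ltW g0) ?(ltW S0).
        rewrite lerBlDr lerDl.
        apply: mulr_ge0; first exact: powR_ge0.
        by apply: mulr_ge0; [exact: powR_ge0|exact: sqr_ge0].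
      by rewrite mulrAC (ler_pdivrMr _ _ S0) [leRHS]mulrC -(ler_pdivrMr _ _ sig0).
    have R1 : ramp (- e) lam T t < 0 by rewrite /ramp mulNr oppr_lt0 ramp_gt0.
    have R2 : lam * ramp (- e) lam T t < 0 by rewrite pmulr_rlt0.
    apply: le_lt_trans R2; rewrite gerDl; apply: mulr_ge0_le0 => //.
    rewrite mulr_ge0 ?powR_ge0// divr_ge0 ?(ltW (b0 _ _))// !mulr_ge0 ?(ltW m0) ?(ltW Lam0)//.
    by rewrite addr_ge0 ?(ltW tau0).
  - by rewrite t1s.
rewrite fE lerBlDr => h.
apply: le_trans (_ : u ts xs + ramp e lam T ts <= _); last first.
  by rewrite lerD2l -[leRHS](rampT e lam T) ramp_homo ?(ltW e0) ?(ltW l0).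
apply: le_trans h; apply: ler_wpM2l; first exact: (ltW (b0 _ ts0)).
apply: powR_homo; rewrite ?(ltW g0) ?le_max ?lexx ?orbT//.
by rewrite ge_max pospart_ge ?(ltW (pospart_gt0 _ _)).
Qed.

End lower_bound.

(** * Spreading of positivity and the sharp lower bound *)

Section spreading.
Context {R : realType} {N : nat}.
Variables (p : R) (u : R -> 'rV[R]_N -> R).
Hypothesis p2 : 2 < p.
Hypothesis u_cont : {within [set z : R * 'rV[R]_N | 0 <= z.1],
    continuous (fun z => u z.1 z.2)}.
Hypothesis u_ge0 : forall t x, 0 <= t -> 0 <= u t x.
Hypothesis u_super : viscosity_supersolution p u.
Local Notation g := ((p - 1) / (p - 2)).

Let m0 : 0 < p - 2. Proof. by rewrite subr_gt0. Qed.
Let p1 : 0 < p - 1. Proof. by have := p2; lra. Qed.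
Let g0 : 0 < g. Proof. by rewrite divr_gt0. Qed.

(** Shifting time makes the amplitude of a barrier as small as desired without
    changing its support, which is adjusted separately by [front_hits]. *)
Lemma height_small (Lam t e : R) : 0 < Lam -> 0 <= t -> 0 < e ->
  exists2 tau, 0 < tau & height p Lam tau t <= e.
Proof.
move=> L0 t0 e0.
have C0 : 0 < (p - 2) * Lam * g `^ (p - 1) by rewrite !mulr_gt0// powR_gt0.
have E0 : 0 < e `^ (- (p - 2)) by rewrite powR_gt0.
pose tau := e `^ (- (p - 2)) / ((p - 2) * Lam * g `^ (p - 1)).
have tau0 : 0 < tau by rewrite divr_gt0.
exists tau => //; apply: le_trans (height_le p2 L0 tau0 (lexx 0) t0) _.
rewrite /height add0r /tau mulrC divfK ?gt_eqF//.
by rewrite -powRrM mulrNN mulfV ?gt_eqF// powRr1// ltW.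
Qed.

Lemma front_unbounded (Lam th tau alpha B : R) : 0 < Lam -> 0 < th -> 0 < tau ->
  exists2 t, 0 <= t & B <= front p Lam th tau alpha t.
Proof.
move=> L0 th0 tau0; pose c := th / (Lam * (p - 2)).
have c0 : 0 < c by rewrite divr_gt0// mulr_gt0.
exists (expR ((B - alpha) / c)); first exact: expR_ge0.
rewrite /front -/c -lerBlDl mulrC -ler_pdivrMr//.
rewrite -[leLHS]expRK ler_ln ?posrE ?expR_gt0//.
  by rewrite lerDl ltW.
by rewrite addr_gt0// expR_gt0.
Qed.

Lemma initial_positivity x0 : 0 < u 0 x0 -> exists2 d, 0 < d &
  exists2 r, 0 < r & forall x, enorm (x - x0) <= r -> d <= u 0 x.
Proof.
move=> u0; exists (u 0 x0 / 2); first by rewrite divr_gt0.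
have u20 : 0 < u 0 x0 / 2 by rewrite divr_gt0.
have C : u z.1 z.2 @[z --> within [set z : R * 'rV[R]_N | 0 <= z.1]
    (nbhs (0, x0))] --> u 0 x0.
  exact: ((@subspace_continuousP _ _ _ (fun z : R * 'rV[R]_N => u z.1 z.2)).1 u_cont ((0, x0) : R * 'rV[R]_N) (lexx (0 : R))).
have : \forall z \near (0 : R, x0), 0 <= z.1 -> u 0 x0 / 2 <= u z.1 z.2.
  have /cvgrPdist_lt /(_ _ u20) := C; rewrite near_withinE.
  apply: filterS => z H z0.
  have := H z0; rewrite ltr_norml => /andP[_ H1].
  by move: H1 u20; lra.
move=> [[P Q] /= [P0 Q0] PQ].
have [r /= r0 Qr] := (nbhs_ballP x0 Q).1 Q0.
exists (r / 2); first by rewrite divr_gt0.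
move=> x xr; apply: (PQ (0, x)) => //=; split=> /=; first exact: nbhs_singleton.
apply: Qr; rewrite -ball_normE /= distrC.
by apply: le_lt_trans (norm_le_enorm _) _; apply: (le_lt_trans xr); lra.
Qed.

Lemma front_hits (Lam th tau a t : R) :
  exists alpha, front p Lam th tau alpha t = a.
Proof.
exists (a - th / (Lam * (p - 2)) * ln (t + tau)).
by rewrite /front subrK.
Qed.

(** With K = 1 the points where the slope is small are those close to [x0], at
    which a barrier supported in a small ball around [x0] stays away from its
    front; [phi1] and [a0] are the values of phi at half the radius and at the
    radius of the ball.  However slow, a logarithmic front reaches everything. *)
Lemma positivity_spreads x0 : 0 < u 0 x0 -> forall rho, exists t1 d1,
  [/\ 0 <= t1, 0 < d1 & forall x, enorm x <= rho -> d1 <= u t1 x].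
Proof.
move=> u00 rho; have [d d0 [r r0 ur]] := initial_positivity u00.
pose phi1 := Num.sqrt (1 + (r / 2) ^+ 2); pose a0 := Num.sqrt (1 + r ^+ 2).
have P1 : 0 <= 1 + (r / 2) ^+ 2 by rewrite addr_ge0// sqr_ge0.
have P0 : 0 <= 1 + r ^+ 2 by rewrite addr_ge0// sqr_ge0.
have phi1_sqr : phi1 ^+ 2 = 1 + (r / 2) ^+ 2 by rewrite sqr_sqrtr.
have a0_sqr : a0 ^+ 2 = 1 + r ^+ 2 by rewrite sqr_sqrtr.
have phi10 : 0 < phi1 by rewrite sqrtr_gt0 ltr_wpDr// sqr_ge0.
have a00 : 0 <= a0 := sqrtr_ge0 _.
have phi1a : phi1 < a0.
  rewrite -ltr_sqr ?nnegrE ?(ltW phi10)// phi1_sqr a0_sqr.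
  by have := r0; nra.
pose s := 1 - (1 / phi1) ^+ 2.
have s0 : 0 < s.
  rewrite /s expr_div_n expr1n phi1_sqr subr_gt0 ltr_pdivrMr.
    by rewrite mul1r ltrDl exprn_gt0// divr_gt0.
  by rewrite ltr_wpDr// sqr_ge0.
(* s is the squared slope on the sphere phi = phi1 *)
pose th1 := Num.sqrt s `^ (p - 2) * s.
have th10 : 0 < th1 by rewrite mulr_gt0// powR_gt0// sqrtr_gt0.
have slope_small x : slope 1 x0 x `^ (p - 2) * slope 1 x0 x ^+ 2 < th1 ->
    sdist 1 x0 x < phi1.
  apply: contraTT; rewrite -!leNgt => h.
  have q0 := slope_ge0 x0 ltr01 x; have S0 := sdist_gt0 x0 ltr01 x.
  have sq : s <= slope 1 x0 x ^+ 2.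
    rewrite (slope_sqr x0 ltr01) /s lerD2l lerN2 ler_sqr ?nnegrE ?divr_ge0 ?(ltW S0) ?(ltW phi10)//.
    by rewrite !mul1r lef_pV2 ?posrE.
  apply: ler_pM; [exact: powR_ge0|exact: ltW| |exact: sq].
  apply: powR_homo; rewrite ?(ltW m0) ?sqrtr_ge0//.
  by rewrite -(ger0_norm q0) -sqrtr_sqr ler_sqrt// sqr_ge0.
pose th := Num.min (th1 / 2) ((a0 - phi1) / g).
have ag : 0 < (a0 - phi1) / g by rewrite divr_gt0// subr_gt0.
have th0 : 0 < th by rewrite lt_min ag divr_gt0.
have th_th1 : th < th1.
  by apply: (@le_lt_trans _ _ (th1 / 2)); [rewrite ge_min lexx|lra].
have gth : phi1 + g * th / 1 <= a0.
  rewrite divr1 -lerBrDl mulrC -ler_pdivlMr//.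
  by rewrite ge_min lexx orbT.
pose Lam := 1 + (N%:R + (p - 2)) / 1 + 1 : R.
have NR0 : 0 <= N%:R :> R by [].
have Lam0 : 0 < Lam by rewrite /Lam divr1 ltr_wpDl// addr_ge0// addr_ge0// ltW.
have ag0 : 0 < (a0 + 1) `^ g by rewrite powR_gt0// ltr_wpDl.
have da : 0 < d / (a0 + 1) `^ g by rewrite divr_gt0.
have [tau tau0 htau] := height_small Lam0 (lexx 0) da.
have [alpha Halpha] := front_hits Lam th tau a0 0.
have [t1 t10 Ht1] := front_unbounded alpha (rho + enorm x0 + 2) Lam0 th0 tau0.
exists t1, (height p Lam tau t1); split=> //; first exact: height_gt0.
move=> x xrho.
have := @subsolution_bound _ _ p u p2 u_cont u_ge0 u_super 1 1 Lam th th1 tau alpha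
  a0 0 d x0 ltr01 ltr01 erefl th0 th_th1 tau0 a00 (lexx 0) _ Halpha _ _ t1 x t10.
move=> H; apply: le_trans (H _ _ _).
- rewrite -[leLHS]mulr1; apply: ler_wpM2l; first by rewrite ltW// height_gt0.
  have e1 : (1 : R) `^ g = 1 by rewrite powR1.
  rewrite -[leLHS]e1; apply: powR_homo; rewrite ?(ltW g0)//.
  rewrite le_max; apply/orP; left.
  have := sdist_le x0 ltr01 x; have := enormD x (- x0).
  have -> : enorm (- x0) = enorm x0 by rewrite -scaleN1r enormZ normrN normr1 mul1r.
  by lra.
- move=> z /slope_small h; apply: le_trans gth; rewrite lerD2r; exact: ltW.
- by rewrite -ler_pdivlMr.
- move=> z za; apply: ur.
  rewrite -ler_sqr ?nnegrE ?enorm_ge0 ?(ltW r0)//.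
  have := sdist_sqr 1 x0 z; rewrite expr1n => E.
  suff : sdist 1 x0 z ^+ 2 <= a0 ^+ 2 by rewrite E a0_sqr lerD2l.
  by rewrite ler_sqr ?nnegrE// ltW// sdist_gt0.
Qed.

(** The curvature term is at most eps for K = (N + p - 2) / eps.  The region of
    small slope is then a large ball, and one first waits until u is positive on
    a larger one. *)
Lemma lower_bound x0 (eps : R) : 0 < u 0 x0 -> 0 < eps -> eps <= 1 / 4 ->
  exists t1 tau alpha, [/\ 0 <= t1, 0 < tau & forall t x, t1 <= t ->
   height p (1 + 2 * eps) tau t *
   Num.max (front p (1 + 2 * eps) (1 - 2 * eps) tau alpha t - enorm x) 0 `^ g
   <= u t x].
Proof.
move=> u00 eps0 eps1.
have Nm : 0 < N%:R + (p - 2) by rewrite ltr_wpDl.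
pose K := (N%:R + (p - 2)) / eps.
have K0 : 0 < K by rewrite divr_gt0.
pose th := 1 - 2 * eps; pose th1 := 1 - eps; pose Lam := 1 + 2 * eps.
have th0 : 0 < th by rewrite /th; lra.
have th_th1 : th < th1 by rewrite /th /th1; lra.
have Lam0 : 0 < Lam by rewrite /Lam; lra.
have LamE : Lam = 1 + (N%:R + (p - 2)) / K + eps.
  by rewrite /Lam /K; field; rewrite !gt_eqF.
have [d d0 Hd] := powR_near1 p eps0.
pose q0 := Num.max (1 / 2) (1 - d).
have q01 : q0 < 1 by rewrite gt_max; apply/andP; split; lra.
have [r r0 Hr] := slope_near1 N K0 q01.
have slope_small (x : 'rV[R]_N) : slope K 0 x `^ (p - 2) * slope K 0 x ^+ 2 < th1 ->
    sdist K 0 x < r.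
  apply: contraTT; rewrite -!leNgt => h.
  have := Hr 0 x h; rewrite ge_max => /andP[q2 qd].
  have qp : 0 < slope K 0 x by apply: lt_le_trans q2; lra.
  have -> : slope K 0 x `^ (p - 2) * slope K 0 x ^+ 2 = slope K 0 x `^ p.
    have -> : p = (p - 2) + 1 + 1 by ring.
    rewrite [in RHS](powR_succ _ qp) [in RHS](powR_succ _ qp) expr2 mulrA.
    by congr (_ `^ _ * _ * _); ring.
  by apply: Hd => //; apply: slope_le1.
pose a0 := r + g * th / eps.
have a00 : 0 <= a0 by rewrite addr_ge0 ?(ltW r0)// divr_ge0 ?(ltW eps0)// mulr_ge0 ?(ltW g0) ?(ltW th0).
have [t1 [d1 [t10 d10 Hd1]]] := positivity_spreads u00 a0.
have ag0 : 0 < (a0 + 1) `^ g by rewrite powR_gt0// ltr_wpDl.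
have da : 0 < d1 / (a0 + 1) `^ g by rewrite divr_gt0.
have [tau tau0 htau] := height_small Lam0 t10 da.
have [alpha Halpha] := front_hits Lam th tau a0 t1.
exists t1, tau, (alpha - K); split=> // t x t1t.
have := @subsolution_bound _ _ p u p2 u_cont u_ge0 u_super K eps Lam th th1 tau alpha
  a0 t1 d1 0 K0 eps0 LamE th0 th_th1 tau0 a00 t10 _ Halpha _ _ t x t1t.
move=> H; apply: le_trans (H _ _ _).
- apply: ler_wpM2l; first by rewrite ltW// height_gt0// (le_trans t10).
  apply: powR_homo; [exact: ltW|by rewrite le_max lexx orbT|].
  rewrite ge_max !le_max lexx !orbT andbT; apply/orP; left.
  have := sdist_le 0 K0 x; rewrite subr0 /front -/Lam -/th.
  by lra.
- by move=> z /slope_small h; rewrite /a0 lerD2r; exact: ltW.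
- by rewrite -ler_pdivlMr.
- move=> z za; apply: Hd1; apply: le_trans za.
  by have := sdist_ge_enorm 0 K0 z; rewrite subr0.
Qed.

End spreading.

(** * Passing to the limit *)

Section asymptotics.
Context {R : realType} {N : nat}.
Variables (p : R) (u : R -> 'rV[R]_N -> R).
Hypothesis p2 : 2 < p.
Local Notation g := ((p - 1) / (p - 2)).
Implicit Types (t : R) (x : 'rV[R]_N).

Let m0 : 0 < p - 2. Proof. by rewrite subr_gt0. Qed.
Let p1 : 0 < p - 1. Proof. by have := p2; lra. Qed.
Let g0 : 0 < g. Proof. by rewrite divr_gt0. Qed.

Definition rescaling t : R := (p - 2) `^ (1 / (p - 2)) * (p - 1) `^ g *
  t `^ (1 / (p - 2)) / (ln t) `^ g.

Lemma rescaling_gt0 t : 0 < t -> 0 < ln t -> 0 < rescaling t.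
Proof. by move=> t0 l0; rewrite divr_gt0 ?mulr_gt0// powR_gt0. Qed.

(** The constant of the theorem normalizes the amplitude of the exact solution:
    the factor left is 1 in the limit when Lam = 1. *)
Lemma rescaled_height Lam tau t (X : R) : 0 < Lam -> 0 < tau -> 0 < t ->
  0 < ln t -> 0 <= X ->
  rescaling t * (height p Lam tau t * X `^ g) =
  (t / (Lam * (t + tau))) `^ (1 / (p - 2)) * ((p - 2) * X / ln t) `^ g.
Proof.
move=> L0 tau0 t0 l0 X0; have s0 : 0 < t + tau by rewrite addr_gt0.
have gp0 : 0 < g `^ (p - 1) by rewrite powR_gt0.
have Lt0 : 0 < Lam * (t + tau) by rewrite mulr_gt0.
have pg : (p - 1) `^ g = (p - 2) `^ g * g `^ g.
  rewrite -powRM ?(ltW m0) ?(ltW g0)//; congr powR; field; rewrite gt_eqF//.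
have gg : (g `^ (p - 1)) `^ (1 / (p - 2)) = g `^ g.
  by rewrite -powRrM; congr powR; field; rewrite gt_eqF.
have hE : height p Lam tau t =
  ((p - 2) `^ (1 / (p - 2)) * g `^ g * (Lam * (t + tau)) `^ (1 / (p - 2)))^-1.
  have -> : height p Lam tau t = ((p - 2) * Lam * g `^ (p - 1) * (t + tau))
      `^ (- (1 / (p - 2))) by rewrite div1r.
  rewrite powRN -gg -!powRM ?mulr_ge0 ?(ltW m0) ?(ltW gp0)
     ?(ltW L0) ?(ltW s0)//.
  by congr ((_ `^ _)^-1); ring.
rewrite /rescaling hE pg (powRM _ (ltW t0)) ?invr_ge0 ?(ltW Lt0)//.
rewrite (powRM _ _ (_ : 0 <= (ln t)^-1)) ?mulr_ge0 ?invr_ge0 ?(ltW l0) ?(ltW m0)//.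
rewrite (powRM _ (ltW m0) X0) !powRVN ?(ltW Lt0) ?(ltW l0)// !powRN.
have a0 : (p - 2) `^ (1 / (p - 2)) != 0 by rewrite gt_eqF// powR_gt0.
have b0 : g `^ g != 0 by rewrite gt_eqF// powR_gt0.
have c0 : (Lam * (t + tau)) `^ (1 / (p - 2)) != 0 by rewrite gt_eqF// powR_gt0.
have d0 : (ln t) `^ g != 0 by rewrite gt_eqF// powR_gt0.
move: (g `^ g) (X `^ g) ((ln t) `^ g) ((p - 2) `^ g) b0 d0 => gG XG lG mG b0 d0.
move: (_ `^ _) (_ `^ _) (_ `^ _) a0 c0 => x1 x2 x3 a0 c0.
by field; rewrite a0 b0 c0 d0.
Qed.

Lemma ln_large (B : R) : \forall t \near +oo, B <= ln t.
Proof.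
near=> t; have tB : expR B <= t by near: t; apply: nbhs_pinfty_ge; exact: num_real.
have t0 : 0 < t by apply: lt_le_trans tB; exact: expR_gt0.
by rewrite -[leLHS]expRK ler_ln ?posrE ?expR_gt0.
Unshelve. all: by end_near. Qed.

(** log(t + tau) - log t is at most log 2 once t >= tau, and log t dominates all
    constants. *)
Lemma front_asymptotics Lam th tau alpha (h : R) : 0 < Lam -> 0 <= th -> 0 < tau ->
  0 < h -> \forall t \near +oo,
  `|(p - 2) * front p Lam th tau alpha t / ln t - th / Lam| <= h.
Proof.
move=> L0 th0 tau0 h0; near=> t.
have tt : tau <= t by near: t; apply: nbhs_pinfty_ge; exact: num_real.
have t1 : 1 <= t by near: t; apply: nbhs_pinfty_ge; exact: num_real.
have t0 : 0 < t by apply: lt_le_trans t1.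
have l1 : 1 <= ln t by near: t; exact: ln_large.
have l0 : 0 < ln t by apply: lt_le_trans l1.
have lB : (`|(p - 2) * alpha| + th / Lam * ln 2) / h <= ln t by near: t; exact: ln_large.
have D0 : 0 <= ln (t + tau) - ln t.
  by rewrite subr_ge0 ler_ln ?posrE ?addr_gt0// lerDl ltW.
have D1 : ln (t + tau) - ln t <= ln 2.
  rewrite lerBlDr -lnM ?posrE// ler_ln ?posrE ?addr_gt0 ?mulr_gt0//.
  by rewrite mulr_natl mulr2n lerD2l.
have tL : 0 <= th / Lam by rewrite divr_ge0// ltW.
have -> : (p - 2) * front p Lam th tau alpha t / ln t - th / Lam =
   ((p - 2) * alpha + th / Lam * (ln (t + tau) - ln t)) / ln t.
  by rewrite /front; field; rewrite !gt_eqF.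
rewrite normrM (ger0_norm (x := (ln t)^-1)) ?invr_ge0 ?(ltW l0)//.
rewrite (ler_pdivrMr _ _ l0) [leRHS]mulrC -(ler_pdivrMr _ _ h0); apply: le_trans lB.
rewrite ler_wpM2r ?invr_ge0 ?(ltW h0)//; apply: le_trans (ler_normD _ _) _.
rewrite lerD2l ger0_norm; last by rewrite mulr_ge0.
by rewrite ler_wpM2l.
Unshelve. all: by end_near. Qed.

Lemma max_scale (a b s : R) : 0 < s -> (p - 2) * Num.max (a - b) 0 / s =
  Num.max ((p - 2) * a / s - (p - 2) * b / s) 0.
Proof.
move=> s0; have c0 : 0 < (p - 2) / s by rewrite divr_gt0.
have -> : (p - 2) * a / s - (p - 2) * b / s = (p - 2) / s * (a - b) by ring.
rewrite mulrAC; have [h|h] := leP (a - b) 0.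
  by rewrite mulr0 max_r// mulr_ge0_le0// ltW.
by rewrite max_l// mulr_ge0 ?(ltW c0) ?(ltW h).
Qed.

Lemma upper_asymptotics (A : R) :
  (forall t x, 0 <= t -> u t x <= height p 1 1 t *
    Num.max (front p 1 1 1 A t - enorm x) 0 `^ g) ->
  forall e, 0 < e -> \forall t \near +oo, forall x,
    rescaling t * u t x <=
    Num.max (1 - (p - 2) * enorm x / ln t) 0 `^ g + e.
Proof.
move=> Hu e e0.
have [d d0 Hd] := powR_unif_right g0 ltr01 e0.
near=> t.
have t0 : 0 < t by near: t; apply: nbhs_pinfty_gt; exact: num_real.
have l1 : 1 <= ln t by near: t; exact: ln_large.
have l0 : 0 < ln t by apply: lt_le_trans l1.
have : `|(p - 2) * front p 1 1 1 A t / ln t - 1 / 1| <= d.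
  by near: t; apply: front_asymptotics.
rewrite ler_norml divr1 => /andP[_ fd] x.
have r0 := rescaling_gt0 t0 l0.
apply: le_trans (_ : rescaling t * (height p 1 1 t *
    Num.max (front p 1 1 1 A t - enorm x) 0 `^ g) <= _).
  by rewrite ler_wpM2l ?(ltW r0)// Hu// ltW.
have X0 : 0 <= Num.max (front p 1 1 1 A t - enorm x) 0 by rewrite le_max lexx orbT.
rewrite rescaled_height// max_scale//.
set w := (p - 2) * enorm x / ln t; set f := _ / ln t in fd *.
have w0 : 0 <= w by rewrite divr_ge0 ?(ltW l0)// mulr_ge0 ?(ltW m0)// enorm_ge0.
have t1 : t / (1 * (t + 1)) <= 1.
  by rewrite mul1r ler_pdivrMr ?mul1r ?lerDl// addr_gt0.
apply: le_trans (_ : Num.max (f - w) 0 `^ g <= _).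
  have t2 : 0 <= t / (1 * (t + 1)) by rewrite mul1r divr_ge0 ?addr_ge0 ?(ltW t0).
  apply: ler_piMl; first exact: powR_ge0.
  by apply: powR_le1 => //; rewrite divr_ge0// ltW.
apply: le_trans (_ : (Num.max (1 - w) 0 + d) `^ g <= _).
  apply: powR_homo; [exact: ltW|by rewrite le_max lexx orbT|].
  rewrite ge_max; apply/andP; split.
    have : 1 - w <= Num.max (1 - w) 0 by rewrite le_max lexx.
    by lra.
  by rewrite addr_ge0 ?(ltW d0)// le_max lexx orbT.
apply: Hd; last by rewrite lexx (ltW d0).
by rewrite le_max lexx orbT/= ge_max ler01 andbT lerBlDr lerDl.
Unshelve. all: by end_near. Qed.

(** The comparison profile may exceed 1, where powers are not uniformly
    continuous and the prefactor [k] <= 1 costs too much; cutting it at 1 loses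
    nothing since the target profile is at most 1. *)
Lemma lower_asymptotics :
  (forall eps, 0 < eps -> eps <= 1 / 4 ->
    exists t1 tau alpha, [/\ 0 <= t1, 0 < tau & forall t x, t1 <= t ->
     height p (1 + 2 * eps) tau t *
     Num.max (front p (1 + 2 * eps) (1 - 2 * eps) tau alpha t - enorm x) 0 `^ g
     <= u t x]) ->
  forall e, 0 < e -> \forall t \near +oo, forall x,
    Num.max (1 - (p - 2) * enorm x / ln t) 0 `^ g - e <= rescaling t * u t x.
Proof.
move=> Hu e e0; have e20 : 0 < e / 2 by rewrite divr_gt0.
have im0 : 0 < 1 / (p - 2) by rewrite divr_gt0.
have [h h0 Hh] := powR_unif_right g0 ltr01 e20.
have [d d0 Hd] := powR_near1 (1 / (p - 2)) e20.
pose eps := Num.min (1 / 4) (Num.min (d / 3) (h / 8)).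
have eps0 : 0 < eps by rewrite !lt_min; apply/and3P; split; lra.
have eps1 : eps <= 1 / 4 by rewrite ge_min lexx.
have epsd : eps <= d / 3 by rewrite !ge_min lexx orbT.
have epsh : eps <= h / 8 by rewrite !ge_min lexx !orbT.
have [t1 [tau [alpha [t10 tau0 Ht]]]] := Hu eps eps0 eps1.
set Lam := 1 + 2 * eps in Ht; set th := 1 - 2 * eps in Ht.
have L0 : 0 < Lam by rewrite /Lam; lra.
have th0 : 0 <= th by rewrite /th; lra.
have h20 : 0 < h / 2 by rewrite divr_gt0.
near=> t.
have t0 : 0 < t by near: t; apply: nbhs_pinfty_gt; exact: num_real.
have tt1 : t1 <= t by near: t; apply: nbhs_pinfty_ge; exact: num_real.
have ttau : tau / eps <= t by near: t; apply: nbhs_pinfty_ge; exact: num_real.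
have l1 : 1 <= ln t by near: t; exact: ln_large.
have l0 : 0 < ln t by apply: lt_le_trans l1.
have : `|(p - 2) * front p Lam th tau alpha t / ln t - th / Lam| <= h / 2.
  by near: t; apply: front_asymptotics.
rewrite ler_norml => /andP[fd _] x.
have r0 := rescaling_gt0 t0 l0.
apply: (@le_trans _ _ (rescaling t * (height p Lam tau t *
    Num.max (front p Lam th tau alpha t - enorm x) 0 `^ g))); last first.
  by apply: ler_wpM2l; [exact: ltW|exact: Ht].
have X0 : 0 <= Num.max (front p Lam th tau alpha t - enorm x) 0.
  by rewrite le_max lexx orbT.
rewrite rescaled_height// max_scale//.
set w := (p - 2) * enorm x / ln t; set f := _ / ln t in fd *.
have w0 : 0 <= w by rewrite divr_ge0 ?(ltW l0)// mulr_ge0 ?(ltW m0)// enorm_ge0.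
have thL : 1 - h / 2 <= th / Lam.
  have eh := mulr_gt0 eps0 h0.
  by rewrite (ler_pdivlMr _ _ L0) /th /Lam; lra.
have f1 : 1 - h <= f by lra.
have kap : 1 - d <= t / (Lam * (t + tau)).
  have tp : 0 < t + tau by rewrite addr_gt0.
  rewrite ler_pdivlMr ?mulr_gt0//.
  have taut : tau <= eps * t by rewrite mulrC -ler_pdivrMr.
  have Y0 : 0 <= Lam * (t + tau) by rewrite mulr_ge0 ?(ltW L0) ?(ltW tp).
  apply: le_trans (_ : (1 - 3 * eps) * (Lam * (t + tau)) <= _).
    by rewrite ler_wpM2r//; lra.
  have e3 : 0 <= 1 - 3 * eps by lra.
  apply: le_trans (_ : (1 - 3 * eps) * (Lam * ((1 + eps) * t)) <= _).
    apply: ler_wpM2l => //; apply: ler_wpM2l; first exact: ltW.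
    by lra.
  rewrite !mulrA ler_piMl ?(ltW t0)// /Lam.
  have : 0 <= eps ^+ 2 + eps ^+ 3 by rewrite addr_ge0 ?exprn_ge0 ?(ltW eps0).
  by have := sqr_ge0 eps; lra.
have kap1 : t / (Lam * (t + tau)) <= 1.
  have tp : 0 < t + tau by rewrite addr_gt0.
  have LP : 0 < Lam * (t + tau) by rewrite mulr_gt0.
  rewrite (ler_pdivrMr _ _ LP) mul1r; apply: le_trans (_ : 1 * (t + tau) <= _).
    by rewrite mul1r lerDl ltW.
  by apply: ler_wpM2r; [exact: ltW|rewrite /Lam lerDl mulr_ge0 ?(ltW eps0)].
have {}kap := Hd _ kap kap1.
set k := _ `^ (1 / (p - 2)) in kap *.
(* the lower profile cut at the maximum of the target profile *)
pose W := Num.min (Num.max (f - w) 0) 1.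
have W0 : 0 <= W by rewrite le_min ler01 andbT le_max lexx orbT.
have W1 : W <= 1 by rewrite ge_min lexx orbT.
have WY : Num.max (1 - w) 0 <= W + h.
  rewrite ge_max addr_ge0 ?(ltW h0)// andbT.
  have [fw|fw] := leP 1 (Num.max (f - w) 0).
    by rewrite /W min_r//; lra.
  rewrite /W min_l ?(ltW fw)//.
  have : f - w <= Num.max (f - w) 0 by rewrite le_max lexx.
  by lra.
have YW : Num.max (1 - w) 0 `^ g <= W `^ g + e / 2.
  apply: le_trans (_ : (W + h) `^ g <= _); last first.
    by apply: Hh; rewrite ?W0 ?lexx ?(ltW h0).
  by apply: powR_homo; [exact: ltW|rewrite le_max lexx orbT|].
have WM : W `^ g <= Num.max (f - w) 0 `^ g.
  by apply: powR_homo => //; [exact: ltW|rewrite ge_min lexx].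
have Wg1 : W `^ g <= 1 by rewrite powR_le1 ?(ltW g0).
have Wg0 := powR_ge0 W g.
apply: le_trans (_ : k * W `^ g <= _); last first.
  by rewrite ler_wpM2l ?powR_ge0.
apply: le_trans (_ : (1 - e / 2) * W `^ g <= _); last by rewrite ler_wpM2r.
have : e / 2 * W `^ g <= e / 2 by rewrite ler_piMr ?(ltW e20).
by lra.
Unshelve. all: by end_near. Qed.

End asymptotics.

(** * The theorem *)

Section conclusions.
Context {R : realType} {N : nat}.

Lemma Linfty_norm_le (f : 'rV[R]_N -> R) (c : R) : 0 <= c ->
  (forall x, `|f x| <= c) ->
  ('N[lebesgueN R N]_+oo[EFin \o f \o @rv_of_tuple R N] <= c%:E)%E.
Proof.
move=> c0 fc; rewrite unlock; case: ifP => _; last by rewrite lee_fin.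
by apply/ess_supP; apply: aeW => t /=; rewrite lee_fin.
Qed.

Lemma ereal_sup_cvg0 (T : Type) (F : R -> T -> R) (x0 : T) :
  (forall t x, 0 <= F t x) ->
  (forall e, 0 < e -> \forall t \near +oo, forall x, F t x <= e) ->
  ereal_sup [set (F t x)%:E | x in [set: T]] @[t --> +oo] --> 0%E.
Proof.
move=> F0 Fe.
have S0 t : (0 <= ereal_sup [set (F t x)%:E | x in [set: T]])%E.
  apply: (@le_trans _ _ (F t x0)%:E); first by rewrite lee_fin.
  by apply: ereal_sup_ubound; exists x0.
have Se e : 0 < e -> \forall t \near +oo,
    (ereal_sup [set (F t x)%:E | x in [set: T]] <= e%:E)%E.
  move=> e0; apply: filterS (Fe e e0) => t Ft.
  by apply: ge_ereal_sup => _ [x _ <-]; rewrite lee_fin.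
apply/fine_cvgP; split.
  apply: filterS (Se 1 ltr01) => t St.
  by rewrite ge0_fin_numE// (le_lt_trans St)// ltry.
apply/cvgrPdist_le => e e0; apply: filterS (Se e e0) => t St /=.
have fin : ereal_sup [set (F t x)%:E | x in [set: T]] \is a fin_num.
  by rewrite ge0_fin_numE// (le_lt_trans St)// ltry.
by rewrite sub0r normrN ger0_norm ?fine_ge0// -lee_fin fineK.
Qed.

End conclusions.

Theorem theorem1p1 (R : realType) (N : nat) (p R0 : R)
    (u0 : 'rV[R]_N -> R) (u : R -> 'rV[R]_N -> R)
    (hN : (1 <= N)%N) (hp : 2 < p)
    (hu0_W : W1oo u0)
    (hu0_ge0 : forall x, 0 <= u0 x)
    (hu0_neq0 : exists x, u0 x != 0)
    (hR0 : 0 < R0)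
    (hu0_supp : closure [set x | u0 x != 0] `<=` [set x | enorm x < R0])
    (hu : cauchy_solution p u0 u) :
  [/\ exists C : R, \forall t \near +oo%R,
        ('N[lebesgueN R N]_+oo[EFin \o u t \o @rv_of_tuple R N] <=
         (C * (t `^ (- (1 / (p - 2))) *
               (ln t) `^ ((p - 1) / (p - 2))))%R%:E)%E,
      exists C : R, \forall t \near +oo%R,
        (ereal_sup [set (enorm x)%:E | x in [set x | (0 < u t x)%R]] <=
         (C * ln t)%R%:E)%E
    & ereal_sup [set (`| (p - 2) `^ (1 / (p - 2)) *
                         (p - 1) `^ ((p - 1) / (p - 2)) *
                         t `^ (1 / (p - 2)) / (ln t) `^ ((p - 1) / (p - 2)) *
                         u t x
                       - (Num.max (1 - (p - 2) * enorm x / ln t) 0)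
                           `^ ((p - 1) / (p - 2)) |)%R%:E
                    | x in [set: 'rV[R]_N]]
        @[t --> +oo%R] --> 0%E].
Proof.
have [uc [M1 uM] u_ge0 _ usub usup u_init] := hu.
have m0 : 0 < p - 2 by rewrite subr_gt0.
have p10 : 0 < p - 1 by lra.
have g0 : 0 < (p - 1) / (p - 2) by rewrite divr_gt0.
pose M := `|M1| + 1.
have M0 : 0 < M by rewrite ltr_wpDl.
have u_le t x : 0 <= t -> u t x <= M.
  move=> t0; apply: le_trans (ler_norm _) _; apply: (le_trans (uM t x t0)).
  by apply: le_trans (ler_norm M1) _; rewrite lerDl.
have u_supp x : R0 <= enorm x -> u 0 x <= 0.
  rewrite u_init => xR; have [->//|ux] := eqVneq (u0 x) 0.
  have : enorm x < R0 by apply: hu0_supp; exact: subset_closure.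
  by rewrite ltNge xR.
have [x0 ux0] := hu0_neq0.
have u00 : 0 < u 0 x0 by rewrite u_init lt_def ux0 hu0_ge0.
have [A Hup] := upper_bound hN hp hR0 M0 uc u_le usub u_supp.
have Uup := upper_asymptotics hp Hup.
have Ulow := lower_asymptotics hp (fun e e0 e1 =>
  lower_bound hp uc u_ge0 usup u00 e0 e1).
split.
(* the rescaled solution is eventually at most 1 + 1, the profile being at most 1 *)
- pose c := 2 / ((p - 2) `^ (1 / (p - 2)) * (p - 1) `^ ((p - 1) / (p - 2))).
  exists c; near=> t.
  have t0 : 0 < t by near: t; apply: nbhs_pinfty_gt; exact: num_real.
  have l1 : 1 <= ln t by near: t; exact: ln_large.
  have l0 : 0 < ln t by apply: lt_le_trans l1.
  have H : forall x, rescaling p t * u t x <=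
    Num.max (1 - (p - 2) * enorm x / ln t) 0 `^ ((p - 1) / (p - 2)) + 1.
    by near: t; exact: Uup.
  have a0 : 0 < (p - 2) `^ (1 / (p - 2)) by rewrite powR_gt0.
  have b0 : 0 < (p - 1) `^ ((p - 1) / (p - 2)) by rewrite powR_gt0.
  have d0 : 0 < t `^ (1 / (p - 2)) by rewrite powR_gt0.
  have e0 : 0 < (ln t) `^ ((p - 1) / (p - 2)) by rewrite powR_gt0.
  have cE : c * (t `^ (- (1 / (p - 2))) * (ln t) `^ ((p - 1) / (p - 2))) =
     2 / rescaling p t.
    rewrite powRN /c /rescaling; move: a0 b0 d0 e0.
    move: (_ `^ _) (_ `^ _) (_ `^ _) (_ `^ _) => x1 x2 x3 x4 ? ? ? ?.
    by field; rewrite !gt_eqF.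
  rewrite cE; have r0 := rescaling_gt0 hp t0 l0.
  apply: Linfty_norm_le => [|x]; first by rewrite divr_ge0// ltW.
  rewrite ger0_norm ?u_ge0 ?(ltW t0)// (ler_pdivlMr _ _ r0) mulrC.
  apply: (le_trans (H x)); rewrite -[leRHS]/(1 + 1) lerD2r.
  apply: powR_le1; [by rewrite le_max lexx orbT| |exact: ltW].
  rewrite ge_max ler01 andbT lerBlDr lerDl.
  by rewrite divr_ge0 ?(ltW l0)// mulr_ge0 ?(ltW m0) ?enorm_ge0.
- exists (2 / (p - 2)); near=> t.
  have t0 : 0 < t by near: t; apply: nbhs_pinfty_gt; exact: num_real.
  have l1 : 1 <= ln t by near: t; exact: ln_large.
  have l0 : 0 < ln t by apply: lt_le_trans l1.
  have : `|(p - 2) * front p 1 1 1 A t / ln t - 1 / 1| <= 1.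
    by near: t; apply: front_asymptotics.
  rewrite ler_norml => /andP[_ F1].
  apply: ge_ereal_sup => _ [x /= ux <-]; rewrite lee_fin.
  have xF : enorm x <= front p 1 1 1 A t.
    rewrite leNgt; apply/negP => Fx; have := Hup t x (ltW t0).
    by rewrite max_r ?subr_le0 ?(ltW Fx)// powR0 ?gt_eqF// mulr0 leNgt ux.
  apply: (le_trans xF).
  have : (p - 2) * front p 1 1 1 A t / ln t <= 2 by lra.
  by rewrite (ler_pdivrMr _ _ l0) mulrAC (ler_pdivlMr _ _ m0) [X in _ -> X <= _]mulrC.
- apply: (@ereal_sup_cvg0 _ _ (fun t x => `|rescaling p t * u t x
     - (Num.max (1 - (p - 2) * enorm x / ln t) 0) `^ ((p - 1) / (p - 2))|) 0) => //.
  move=> e e0; near=> t => x; rewrite ler_norml.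
  have : forall x, rescaling p t * u t x <=
    Num.max (1 - (p - 2) * enorm x / ln t) 0 `^ ((p - 1) / (p - 2)) + e.
    by near: t; exact: Uup.
  have : forall x, Num.max (1 - (p - 2) * enorm x / ln t) 0
     `^ ((p - 1) / (p - 2)) - e <= rescaling p t * u t x.
    by near: t; exact: Ulow.
  by move=> /(_ x) h1 /(_ x) h2; apply/andP; split; lra.
Unshelve. all: by end_near. Qed.
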